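(* Let $(g,h)$ and $(g',h')$ be two constraint map-germs with non-empty feasible set-germs, with the same number $q$ of inequality constraints and the same number $r$ of equality constraints. Suppose that some reduction $(g,h)_{\iota_{(i)},(k)}$ of $(g,h)$ and some reduction $(g',h')_{\iota_{(i')},(k')}$ of $(g',h')$ are $\mathcal K[G]$-equivalent. Then $(g,h)$ and $(g',h')$ are $\mathcal K[G]$-equivalent.
   Context: A constraint map-germ is a smooth map-germ $(g,h):(\mathbb R^n,0)\to\mathbb R^q\times\mathbb R^r$ with $h(0)=0$; its feasible set-germ is the germ at $0$ of $\{x: g_i(x)\le0\ \forall i,\ h_j(x)=0\ \forall j\}$; it is non-empty iff $g_j(0)\le0$ for all $j$. $\mathcal K[G]$-equivalence: two constraint map-germs $(g,h),(g',h')$ with the same source dimension $n$ and the same $q,r$ are $\mathcal K[G]$-equivalent if there are a diffeomorphism-germ $\Phi:(\mathbb R^n,0)\to(\mathbb R^n,0)$ and smooth germs at $0\in\mathbb R^n$ of matrix-valued maps $C$ ($q\times q$, each $C(x)$ a product of a diagonal matrix with positive diagonal entries and a permutation matrix), $B$ ($q\times r$, arbitrary), $A$ ($r\times r$, each $A(x)$ invertible) with $g(x)=C(x)g'(\Phi^{-1}(x))+B(x)h'(\Phi^{-1}(x))$ and $h(x)=A(x)h'(\Phi^{-1}(x))$. Reduction (defined when the feasible set-germ is non-empty): let $(k)=(k_1,\dots,k_{q-s})$ be a set of indices in $\{1,\dots,q\}$ with $g_{k_a}(0)<0$ for all $a$, and $(i)=(i_1,\dots,i_{r-\ell})$ a set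 of indices in $\{1,\dots,r\}$ such that $d(h_{i_1})_0,\dots,d(h_{i_{r-\ell}})_0$ are linearly independent. Let $\iota_{(i)}:(\mathbb R^{n-r+\ell},0)\to(\mathbb R^n,0)$ be an immersion-germ onto the submanifold-germ $(h_{i_1},\dots,h_{i_{r-\ell}})^{-1}(0)$. The reduction $(g,h)_{\iota_{(i)},(k)}:(\mathbb R^{n-r+\ell},0)\to\mathbb R^{s}\times\mathbb R^{\ell}$ is the constraint map-germ whose inequality components are $g_j\circ\iota_{(i)}$ for $j\notin(k)$ and whose equality components are $h_j\circ\iota_{(i)}$ for $j\notin(i)$. *)

(* Defs.v *)
From HB Require Import structures.
From mathcomp Require Import all_boot all_order all_algebra all_fingroup.
From mathcomp Require Import all_classical all_reals all_analysis.
Import Order.TTheory GRing.Theory Num.Theory.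
Import numFieldNormedType.Exports.

Set Implicit Arguments.
Unset Strict Implicit.
Unset Printing Implicit Defensive.

Local Open Scope classical_set_scope.
Local Open Scope ring_scope.

(* Germs at 0 are represented by total functions, whose values away from 0 are *)
(* irrelevant to the predicates on germs.  Points of the source are row        *)
(* vectors (as in derive.v); constraint values are column vectors, so that     *)
(* matrices act on them from the left.                                         *)

(* C^k on an open set U.  The source is finite-dimensional, so it is enough to *)
(* ask for the regularity of each directional derivative.                      *)
Fixpoint Ck_on (R : realType) (n : nat) (W : normedModType R)
    (U : set 'rV[R]_n) (k : nat) (f : 'rV[R]_n -> W) : Prop :=
  match k with
  | 0 => forall x, U x -> {for x, continuous f}
  | k'.+1 => (forall x, U x -> differentiable f x) /\
             (forall v : 'rV[R]_n, Ck_on U k' ('D_v f))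
  end.

(* The neighbourhood U does not depend on the order of differentiation. *)
Definition smooth_germ (R : realType) (n : nat) (W : normedModType R)
    (f : 'rV[R]_n -> W) : Prop :=
  exists U : set 'rV[R]_n,
    [/\ open U, U 0 & forall k : nat, Ck_on U k f].

(* Psi represents the inverse germ of Phi. *)
Definition diffeo_germ (R : realType) (n n' : nat)
    (Phi : 'rV[R]_n' -> 'rV[R]_n) (Psi : 'rV[R]_n -> 'rV[R]_n') : Prop :=
  [/\ smooth_germ Phi /\ Phi 0 = 0,
      smooth_germ Psi /\ Psi 0 = 0,
      \forall x \near (0 : 'rV[R]_n'), Psi (Phi x) = x &
      \forall x \near (0 : 'rV[R]_n), Phi (Psi x) = x].

Record constraint_map (R : realType) (n q r : nat) := ConstraintMap {
  ineq : 'rV[R]_n -> 'cV[R]_q ;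
  equa : 'rV[R]_n -> 'cV[R]_r }.

Definition constraint_germ (R : realType) (n q r : nat)
    (F : constraint_map R n q r) : Prop :=
  [/\ smooth_germ (ineq F), smooth_germ (equa F) & equa F 0 = 0].

Definition feasible_set (R : realType) (n q r : nat)
    (F : constraint_map R n q r) : set 'rV[R]_n :=
  [set x | (forall i, ineq F x i ord0 <= 0) /\
           (forall j, equa F x j ord0 = 0)].

(* The germ at 0 of a set is non-empty iff the set meets every neighbourhood   *)
(* of 0.                                                                       *)
Definition nonempty_feasible_germ (R : realType) (n q r : nat)
    (F : constraint_map R n q r) : Prop :=
  closure (feasible_set F) 0.

Definition pos_diag_perm_mx (R : realType) (q : nat) (M : 'M[R]_q) : Prop :=
  exists (d : 'rV[R]_q) (s : 'S_q),
    (forall i, 0 < d ord0 i) /\ M = diag_mx d *m perm_mx s.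

(* The two source dimensions are separate parameters, required to be equal,    *)
(* so that no cast is needed.                                                  *)
Definition KG_equiv (R : realType) (n n' q r : nat)
    (F : constraint_map R n q r) (F' : constraint_map R n' q r) : Prop :=
  n = n' /\
  exists (Phi : 'rV[R]_n' -> 'rV[R]_n) (Psi : 'rV[R]_n -> 'rV[R]_n')
         (C : 'rV[R]_n -> 'M[R]_q) (B : 'rV[R]_n -> 'M[R]_(q, r))
         (A : 'rV[R]_n -> 'M[R]_r),
    [/\ diffeo_germ Phi Psi,
        [/\ smooth_germ C, smooth_germ B & smooth_germ A],
        \forall x \near (0 : 'rV[R]_n), pos_diag_perm_mx (C x),
        \forall x \near (0 : 'rV[R]_n), A x \in unitmx &
        \forall x \near (0 : 'rV[R]_n),
          ineq F x = C x *m ineq F' (Psi x) + B x *m equa F' (Psi x) /\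
          equa F x = A x *m equa F' (Psi x)].

Definition zero_set (R : realType) (n r : nat)
    (h : 'rV[R]_n -> 'cV[R]_r) (I : {set 'I_r}) : set 'rV[R]_n :=
  [set x | forall i, i \in I -> h x i ord0 = 0].

Definition independent_differentials (R : realType) (n r : nat)
    (h : 'rV[R]_n -> 'cV[R]_r) (I : {set 'I_r}) : Prop :=
  forall c : 'I_r -> R,
    (forall v : 'rV[R]_n,
       \sum_(i in I) c i * 'd (fun x => h x i ord0 : R) (0 : 'rV[R]_n) v = 0) ->
    forall i, i \in I -> c i = 0.

(* The last two conditions say that the image of each small enough             *)
(* neighbourhood of 0 under iota has the same germ at 0 as Z.                  *)
Definition immersion_germ_onto (R : realType) (m n : nat)
    (iota : 'rV[R]_m -> 'rV[R]_n) (Z : set 'rV[R]_n) : Prop :=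
  [/\ smooth_germ iota /\ iota 0 = 0,
      injective ('d iota (0 : 'rV[R]_m)),
      \forall x \near (0 : 'rV[R]_m), Z (iota x) &
      forall U : set 'rV[R]_m, nbhs (0 : 'rV[R]_m) U ->
        \forall y \near (0 : 'rV[R]_n), Z y -> (iota @` U) y].

(* sigma lists the indices outside K without repetition. *)
Definition enumerates_compl (s q : nat) (sigma : 'I_s -> 'I_q)
    (K : {set 'I_q}) : Prop :=
  injective sigma /\ (forall j, (j \notin K) <-> exists a, sigma a = j).

(* E is a reduction of F: K is the set of removed inequality constraints, I    *)
(* that of removed equality constraints.                                       *)
Definition reduction_of (R : realType) (n q r m s l : nat)
    (F : constraint_map R n q r) (E : constraint_map R m s l) : Prop :=
  exists (K : {set 'I_q}) (I : {set 'I_r})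
         (sigma : 'I_s -> 'I_q) (tau : 'I_l -> 'I_r)
         (iota : 'rV[R]_m -> 'rV[R]_n),
    [/\ [/\ (s + #|K| = q)%N, (l + #|I| = r)%N & (m + #|I| = n)%N],
        forall k, k \in K -> ineq F 0 k ord0 < 0,
        independent_differentials (equa F) I,
        immersion_germ_onto iota (zero_set (equa F) I) &
        [/\ enumerates_compl sigma K, enumerates_compl tau I &
            \forall x \near (0 : 'rV[R]_m),
              ineq E x = rowsub sigma (ineq F (iota x)) /\
              equa E x = rowsub tau (equa F (iota x))]].

(* Main.v *)
(* The equality constraints h_I with independent differentials are straightened
   by the chart (y, z) |-> iota y + z W, where W is a left inverse of the
   Jacobian of h_I at 0.  By Hadamard's lemma every component of F differs from
   its restriction to z = 0 by a smooth linear combination of the coordinates z,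
   and these coordinates are themselves an invertible smooth combination of the
   components of h_I.  A constraint that is negative at 0 is a positive multiple
   of the constant -1.  Hence F is equivalent to the suspension of its reduction,
   obtained by adjoining the equalities z = 0 and constant inequalities -1 <= 0;
   as the suspension preserves equivalence, the theorem follows by symmetry and
   transitivity.

   The inverse function theorem comes from the Banach fixed point theorem, its
   smoothness from D(f^-1) = (Df)^-1 o f^-1.  Hadamard's quotients are
   means over s in [0, 1] of partial derivatives at (y, s z); with the weights
   s^p such means form a family closed under differentiation, which makes the
   induction on the order of differentiability work. *)

From HB Require Import structures.
Require Import Defs.
From mathcomp Require Import all_boot all_order all_algebra all_fingroup.
From mathcomp Require Import all_classical all_reals all_analysis.
From mathcomp Require Import ring lra.
Import Order.TTheory GRing.Theory Num.Theory.
Import numFieldNormedType.Exports.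

Set Implicit Arguments.
Unset Strict Implicit.
Unset Printing Implicit Defensive.

Local Open Scope classical_set_scope.
Local Open Scope ring_scope.

(** * Differentiability classes *)

Section Differentiability.
Variables (R : realType) (V W : normedModType R).
Implicit Types f g : V -> W.

(** A little-o expansion determines the differential, and unfolding the little-o gives the estimate
    in [e]; later candidates for a differential are verified through this estimate. *)
Lemma differentiable_dist f (L : {linear V -> W}) (x : V) :
  continuous L ->
  (forall e, 0 < e ->
    \forall h \near (0 : V), `|f (h + x) - f x - L h| <= e * `|h|) ->
  differentiable f x /\ 'd f x = L :> (V -> W).
Proof.
move=> cL H.
have fL : f \o shift x = cst (f x) + L +o_ (0 : V) id.
  apply/eqaddoP => e e0; near=> h.
  rewrite -[X in `|X|]/(f (h + x) - (f x + L h)) opprD addrA.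
  by near: h; exact: H.
have dL := diff_unique cL fL.
split=> //; apply/diff_locallyP; rewrite dL; split => //.
Unshelve. all: by end_near. Qed.

Lemma dist_differentiable f (x : V) : differentiable f x ->
  forall e, 0 < e ->
    \forall h \near (0 : V), `|f (h + x) - f x - 'd f x h| <= e * `|h|.
Proof.
move=> /diff_locally /eqaddoP H e /H; apply: filterS => h.
by rewrite -[X in `|X|]/(f (h + x) - (f x + 'd f x h)) opprD addrA.
Qed.

Lemma near_eq_differentiable f g (x : V) :
  {near x, f =1 g} -> differentiable f x -> differentiable g x.
Proof.
move=> fg df.
have [] // := @differentiable_dist g ('d f x) x (diff_continuous df) => e e0.
have fg0 : \forall h \near (0 : V), f (h + x) = g (h + x).
  by move: fg; rewrite (near_shift 0)/= subr0.
near=> h.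
rewrite -(near fg0 h) // -(nbhs_singleton fg).
by near: h; exact: dist_differentiable.
Unshelve. all: by end_near. Qed.

End Differentiability.

(** * Stability properties of the classes C^k on an open set *)

Section CkGeneral.
Variables (R : realType) (n : nat).
Implicit Types (U V : set 'rV[R]_n) (k : nat).

Lemma near_open U x (P : 'rV[R]_n -> Prop) : open U -> U x ->
  (forall y, U y -> P y) -> \forall y \near x, P y.
Proof. by move=> oU Ux UP; apply: filterS (open_nbhs_nbhs (conj oU Ux)). Qed.

Lemma Ck_on_ext (W : normedModType R) U k (f g : 'rV[R]_n -> W) : open U ->
  (forall x, U x -> f x = g x) -> Ck_on U k f -> Ck_on U k g.
Proof.
move=> oU; elim: k f g => [|k IH] f g fg /=.
  move=> cf x Ux.
  have fg' : \forall y \near x, f y = g y by exact: near_open Ux _.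
  rewrite /prop_for /continuous_at -(fg x Ux).
  exact: cvg_trans (near_eq_cvg fg') (cf x Ux).
move=> [df cf]; split=> [x Ux|v].
  by apply: near_eq_differentiable (df x Ux); exact: near_open Ux _.
apply: IH (cf v) => x Ux.
by apply: near_eq_derive; exact: near_open Ux _.
Qed.

Lemma Ck_onS (W : normedModType R) U V k (f : 'rV[R]_n -> W) :
  V `<=` U -> Ck_on U k f -> Ck_on V k f.
Proof.
move=> VU; elim: k f => [|k IH] f /=; first by move=> cf x /VU/cf.
by move=> [df cf]; split=> [x /VU/df //|v]; exact: IH.
Qed.

Lemma Ck_on_pred (W : normedModType R) U k (f : 'rV[R]_n -> W) :
  Ck_on U k.+1 f -> Ck_on U k f.
Proof.
elim: k f => [|k IH] f [df cf].
  by move=> x Ux; exact: differentiable_continuous (df x Ux).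
by split=> // v; exact: IH.
Qed.

Lemma Ck_on_continuous (W : normedModType R) U k (f : 'rV[R]_n -> W) x :
  Ck_on U k f -> U x -> {for x, continuous f}.
Proof. by elim: k => [|k IH] H; [exact: H | apply: IH; exact: Ck_on_pred]. Qed.

Lemma Ck_on_cst (W : normedModType R) U k (a : W) :
  Ck_on U k (fun _ : 'rV[R]_n => a).
Proof.
elim: k a => [|k IH] a /=; first by move=> x _; exact: cst_continuous.
split=> [x _|v]; first exact: differentiable_cst.
rewrite (_ : 'D_v _ = fun _ => 0) //; apply/funext => x.
exact: derive_cst.
Qed.

Lemma Ck_onD (W : normedModType R) U k (f g : 'rV[R]_n -> W) : open U ->
  Ck_on U k f -> Ck_on U k g -> Ck_on U k (fun x => f x + g x).
Proof.
move=> oU; elim: k f g => [|k IH] f g /=.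
  by move=> cf cg x Ux; exact: (cvgD (cf x Ux) (cg x Ux)).
move=> [df cf] [dg cg]; split=> [x Ux|v].
  by apply: differentiableD; [exact: df|exact: dg].
apply: Ck_on_ext (IH _ _ (cf v) (cg v)) => // x Ux.
by rewrite [RHS]deriveD //; apply: diff_derivable; [exact: df|exact: dg].
Qed.

Lemma Ck_on_coord U k (j : 'I_n) : Ck_on U k (fun x : 'rV[R]_n => x ord0 j : R).
Proof.
case: k => [|k] /=; first by move=> x _; exact: coord_continuous.
split=> [x _|v]; first exact: differentiable_coord.
rewrite (_ : 'D_v _ = fun _ => v ord0 j); first exact: Ck_on_cst.
apply/funext => x; have dx : derivable (id : 'rV[R]_n -> 'rV[R]_n) x v by exact: derivable_id.
by have /matrixP/(_ ord0 j) := derive_mx dx; rewrite mxE derive_id.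
Qed.

Lemma Ck_onM U k (f g : 'rV[R]_n -> R) : open U ->
  Ck_on U k f -> Ck_on U k g -> Ck_on U k (fun x => f x * g x).
Proof.
move=> oU; elim: k f g => [|k IH] f g.
  by move=> cf cg x Ux; exact: (cvgM (cf x Ux) (cg x Ux)).
move=> Cf Cg; have [df cf] := Cf; have [dg cg] := Cg; split=> [x Ux|v].
  by apply: differentiableM; [exact: df|exact: dg].
apply: (@Ck_on_ext _ _ _ (fun x => f x * 'D_v g x + g x * 'D_v f x)) => //.
  move=> x Ux.
  by rewrite [RHS]deriveM //; apply: diff_derivable; [exact: df|exact: dg].
by apply: Ck_onD => //; apply: IH => //; by [exact: Ck_on_pred|exact: cf|exact: cg].
Qed.

Lemma Ck_onN (W : normedModType R) U k (f : 'rV[R]_n -> W) : open U ->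
  Ck_on U k f -> Ck_on U k (fun x => - f x).
Proof.
move=> oU; elim: k f => [|k IH] f /=.
  by move=> cf x Ux; exact: (cvgN (cf x Ux)).
move=> [df cf]; split=> [x Ux|v]; first by apply: differentiableN; exact: df.
apply: Ck_on_ext (IH _ (cf v)) => // x Ux.
by rewrite [RHS]deriveN //; apply: diff_derivable; exact: df.
Qed.

Lemma Ck_on_sum (W : normedModType R) (I : Type) (r : seq I) (P : pred I) U k
    (f : I -> 'rV[R]_n -> W) : open U ->
  (forall i, P i -> Ck_on U k (f i)) ->
  Ck_on U k (fun x => \sum_(i <- r | P i) f i x).
Proof.
move=> oU Cf; elim: r => [|i r IH].
  apply: (@Ck_on_ext _ _ _ (fun=> 0)) => //; last exact: Ck_on_cst.
  by move=> x _; rewrite big_nil.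
case Pi: (P i); last first.
  by apply: Ck_on_ext IH => // x _; rewrite big_cons Pi.
apply: Ck_on_ext (Ck_onD oU (Cf i Pi) IH) => // x _.
by rewrite big_cons Pi.
Qed.

Lemma Ck_on_prod (I : Type) (r : seq I) (P : pred I) U k
    (f : I -> 'rV[R]_n -> R) : open U ->
  (forall i, P i -> Ck_on U k (f i)) ->
  Ck_on U k (fun x => \prod_(i <- r | P i) f i x).
Proof.
move=> oU Cf; elim: r => [|i r IH].
  apply: (@Ck_on_ext _ _ _ (fun=> 1 : R)) => //; last exact: Ck_on_cst.
  by move=> x _; rewrite big_nil.
case Pi: (P i); last first.
  by apply: Ck_on_ext IH => // x _; rewrite big_cons Pi.
apply: Ck_on_ext (Ck_onM oU (Cf i Pi) IH) => // x _.
by rewrite big_cons Pi.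
Qed.

Lemma Ck_onV U k (f : 'rV[R]_n -> R) : open U -> (forall x, U x -> f x != 0) ->
  Ck_on U k f -> Ck_on U k (fun x => (f x)^-1).
Proof.
move=> oU f0; elim: k => [|k IH].
  by move=> cf x Ux; exact: (cvgV (f0 x Ux) (cf x Ux)).
move=> Cf; have [df cf] := Cf; split=> [x Ux|v].
  by apply: differentiableV; [exact: df|exact: f0].
apply: (@Ck_on_ext _ _ _ (fun x => - ((f x)^-1 * (f x)^-1 * 'D_v f x))) => //.
  move=> x Ux; rewrite [RHS]deriveV ?f0 //; last exact/diff_derivable/df.
  by rewrite -exprVn expr2 scaleNr.
have C1 : Ck_on U k (fun x => (f x)^-1) by apply: IH; exact: Ck_on_pred.
by apply: Ck_onN => //; apply: Ck_onM => //; [exact: Ck_onM|exact: cf].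
Qed.

Lemma derive_coord (a b : nat) (f : 'rV[R]_n -> 'M[R]_(a, b)) x v i j :
  differentiable f x -> 'D_v (fun y => f y i j : R) x = 'D_v f x i j.
Proof. by move=> df; rewrite derive_mx ?mxE //; exact: diff_derivable. Qed.

Lemma continuous_mxP (T : topologicalType) (a b : nat) (f : T -> 'M[R]_(a, b))
    (x : T) :
  {for x, continuous f} <-> forall i j, {for x, continuous (fun y => f y i j)}.
Proof.
split=> [cf i j|cf].
  by apply: (@continuous_comp _ _ _ f (fun M : 'M[R]_(a, b) => M i j)) => //;
    exact: coord_continuous.
apply/cvgrPdist_lt => e e0; near=> y.
rewrite [ltLHS]/Num.Def.normr/= mx_normrE.
apply/bigmax_ltP; split=> //= ij _.
rewrite !mxE; move: ij; near: y; apply: filter_forall => -[i j] /=.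
exact: (cvgrPdist_lt _ _).1 (cf i j) e e0.
Unshelve. all: by end_near. Qed.

(** For the converse, the differentials of the entries are assembled into one linear map [L]; since
    the norm of a matrix is the largest absolute value of its entries, the remainder is estimated
    entrywise. *)
Lemma differentiable_mxP (a b : nat) (f : 'rV[R]_n -> 'M[R]_(a, b)) x :
  differentiable f x <-> forall i j, differentiable (fun y => f y i j : R) x.
Proof.
split=> [df i j|df].
  exact: (@differentiable_comp _ _ _ _ f (fun M : 'M[R]_(a, b) => M i j : R))
    (differentiable_coord _ _ _).
pose L := fun v => \matrix_(i < a, j < b) ('d (fun y => f y i j : R) x v).
have linL : linear L.
  by move=> c u v; apply/matrixP => i j; rewrite !mxE linearP.
pose LL := GRing.isLinear.Build _ _ _ _ L linL.
pose Lf : {linear 'rV[R]_n -> 'M[R]_(a, b)} := HB.pack L LL.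
have [] // := @differentiable_dist _ _ _ f Lf x.
  move=> u; apply/continuous_mxP => i j /=.
  rewrite (_ : (fun y => _) = 'd (fun y => f y i j : R) x); last first.
    by apply/funext => v; rewrite /L mxE.
  exact: diff_continuous.
move=> e e0; near=> h.
rewrite [leLHS]/Num.Def.normr/= mx_normrE.
rewrite (bigmax_le _ _)//=; first by rewrite mulr_ge0 // ltW.
move=> [i j] _ /=; rewrite 4!mxE [L h i j]mxE.
move: i j; near: h; apply: filter_forall => i; apply: filter_forall => j.
exact: (@dist_differentiable _ _ _ (fun y => f y i j : R) x (df i j) e e0).
Unshelve. all: by end_near. Qed.

Lemma Ck_on_mxP (a b : nat) U k (f : 'rV[R]_n -> 'M[R]_(a, b)) : open U ->
  Ck_on U k f <-> forall i j, Ck_on U k (fun x => f x i j : R).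
Proof.
move=> oU; elim: k f => [|k IH] f.
  split=> [cf i j x Ux|cf x Ux]; first exact: (continuous_mxP _ _).1 (cf x Ux) i j.
  by apply/continuous_mxP => i j; exact: cf.
split=> [[df cf] i j|Cf].
  split=> [x Ux|v]; first exact: (differentiable_mxP _ _).1 (df x Ux) i j.
  apply: Ck_on_ext ((IH _).1 (cf v) i j) => // x Ux.
  by rewrite derive_coord //; exact: df.
have df x : U x -> differentiable f x.
  by move=> Ux; apply/differentiable_mxP => i j; exact: (Cf i j).1.
split=> // v; apply/IH => i j.
apply: Ck_on_ext ((Cf i j).2 v) => // x Ux.
by rewrite derive_coord //; exact: df.
Qed.

Lemma Ck_on_mulmx (a b c : nat) U k (f : 'rV[R]_n -> 'M[R]_(a, b))
    (g : 'rV[R]_n -> 'M[R]_(b, c)) : open U ->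
  Ck_on U k f -> Ck_on U k g -> Ck_on U k (fun x => f x *m g x).
Proof.
move=> oU /(Ck_on_mxP _ _ oU) Cf /(Ck_on_mxP _ _ oU) Cg; apply/Ck_on_mxP => // i j.
apply: (@Ck_on_ext _ _ _ (fun x => \sum_l f x i l * g x l j)) => //.
  by move=> x _; rewrite mxE.
by apply: Ck_on_sum => // l _; exact: Ck_onM.
Qed.

Lemma Ck_on_det (a : nat) U k (f : 'rV[R]_n -> 'M[R]_a) : open U ->
  (forall i j, Ck_on U k (fun x => f x i j : R)) ->
  Ck_on U k (fun x => \det (f x)).
Proof.
move=> oU Cf; apply: Ck_on_sum => // s _.
by apply: Ck_onM => //; [exact: Ck_on_cst | exact: Ck_on_prod].
Qed.

(** By Cramer's rule the entries of the inverse are cofactors divided by the determinant, which does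
    not vanish on [U]. *)
Lemma Ck_on_invmx (a : nat) U k (f : 'rV[R]_n -> 'M[R]_a) : open U ->
  (forall x, U x -> f x \in unitmx) ->
  Ck_on U k f -> Ck_on U k (fun x => invmx (f x)).
Proof.
move=> oU fu /(Ck_on_mxP _ _ oU) Cf; apply/Ck_on_mxP => // i j.
apply: (@Ck_on_ext _ _ _
    (fun x => (\det (f x))^-1 * ((-1) ^+ (j + i) * \det (row' j (col' i (f x)))))).
- by [].
- by move=> x /fu fx; rewrite /invmx fx !mxE.
- apply: Ck_onM => //.
    apply: Ck_onV => //; last exact: Ck_on_det.
    by move=> x /fu; rewrite unitmxE unitfE.
  apply: Ck_onM => //; first exact: Ck_on_cst.
  apply: Ck_on_det => // i' j'.
  by apply: Ck_on_ext (Cf (lift j i') (lift i j')) => // x _; rewrite !mxE.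
Qed.

Lemma derive_sum_delta (W : normedModType R) (f : 'rV[R]_n -> W) x v :
  differentiable f x ->
  'D_v f x = \sum_j v ord0 j *: 'D_(delta_mx ord0 j) f x.
Proof.
move=> df; rewrite deriveE // [in LHS](row_sum_delta v) linear_sum /=.
by apply: eq_bigr => j _; rewrite linearZ /= deriveE.
Qed.

End CkGeneral.

(** By the chain rule a derivative of [f \o g] is a sum of products of derivatives of coordinates of
    [g] with partial derivatives of [f] composed with [g]; the induction hypothesis applies to these
    composites. *)
Lemma Ck_on_comp (R : realType) (m n : nat) (V : set 'rV[R]_m) (U : set 'rV[R]_n)
    k (f : 'rV[R]_n -> R) (g : 'rV[R]_m -> 'rV[R]_n) : open V ->
  (forall x, V x -> U (g x)) ->
  Ck_on U k f -> Ck_on V k g -> Ck_on V k (f \o g).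
Proof.
move=> oV VU; elim: k f => [|k IH] f.
  by move=> cf cg x Vx; apply: continuous_comp; [exact: cg | exact/cf/VU].
move=> Cf Cg; have [df cf] := Cf; have [dg cg] := Cg; split=> [x Vx|v].
  exact: differentiable_comp (dg x Vx) (df _ (VU x Vx)).
apply: (@Ck_on_ext _ _ _ _ _
    (fun x => \sum_j 'D_v g x ord0 j * ('D_(delta_mx ord0 j) f \o g) x)) => //.
  move=> x Vx; have dgx := dg x Vx; have dfg := df _ (VU x Vx).
  rewrite [RHS]deriveE; last exact: differentiable_comp.
  rewrite (diff_comp dgx dfg) /= -(deriveE _ dgx) -(deriveE _ dfg).
  by rewrite [RHS]derive_sum_delta.
apply: Ck_on_sum => // j _; apply: Ck_onM => //.
  exact: ((Ck_on_mxP _ _ oV).1 (cg v) ord0 j).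
by apply: IH; [exact: cf | exact: Ck_on_pred].
Qed.

Lemma Ck_on_comp_mx (R : realType) (m n a b : nat) (V : set 'rV[R]_m)
    (U : set 'rV[R]_n) k (f : 'rV[R]_n -> 'M[R]_(a, b))
    (g : 'rV[R]_m -> 'rV[R]_n) : open V -> open U ->
  (forall x, V x -> U (g x)) ->
  Ck_on U k f -> Ck_on V k g -> Ck_on V k (f \o g).
Proof.
move=> oV oU VU Cf Cg; apply/Ck_on_mxP => // i j.
have /(_ i j) := (Ck_on_mxP _ _ oU).1 Cf.
by move=> Cfij; exact: Ck_on_comp Cfij Cg.
Qed.

(** * Smooth germs *)

Section SmoothGerms.
Variables (R : realType) (n : nat).

(** In terms of all small radii, a common ball for finitely many smooth germs comes from the filter
    properties of [0^'+]. *)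
Lemma smooth_germP (W : normedModType R) (f : 'rV[R]_n -> W) :
  smooth_germ f <->
  \forall e \near 0^'+, forall k, Ck_on (ball (0 : 'rV[R]_n) e) k f.
Proof.
split=> [[U [oU U0 Cf]]|].
  by apply: filterS (open_subball oU U0) => e eU k; exact: Ck_onS eU (Cf k).
move=> Cf; near (0 : R)^'+ => e; exists (ball 0 e); split.
- exact: ball_open.
- exact: ballxx.
- by near: e.
Unshelve. all: by end_near. Qed.

Lemma nbhs_ball0 (A : set 'rV[R]_n) :
  nbhs (0 : 'rV[R]_n) A -> \forall e \near 0^'+, ball (0 : 'rV[R]_n) e `<=` A.
Proof.
rewrite nbhsE => -[B [oB B0] BA].
by apply: filterS (open_subball oB B0) => e eB; exact: subset_trans eB BA.
Qed.

Lemma smooth_germ_continuous (W : normedModType R) (f : 'rV[R]_n -> W) :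
  smooth_germ f -> {for 0, continuous f}.
Proof. by move=> [U [oU U0 Cf]]; exact: Ck_on_continuous (Cf 0%N) U0. Qed.

Lemma smooth_germ_differentiable (W : normedModType R) (f : 'rV[R]_n -> W) :
  smooth_germ f -> \forall x \near (0 : 'rV[R]_n), differentiable f x.
Proof.
move=> [U [oU U0 Cf]]; apply: near_open oU U0 _ => x Ux.
exact: (Cf 1%N).1.
Qed.

Lemma smooth_germ_differentiable0 (W : normedModType R) (f : 'rV[R]_n -> W) :
  smooth_germ f -> differentiable f 0.
Proof. by move/smooth_germ_differentiable/nbhs_singleton. Qed.

Lemma smooth_germ_cst (W : normedModType R) (a : W) :
  smooth_germ (fun _ : 'rV[R]_n => a).
Proof. by exists setT; split=> // [|k]; [exact: openT | exact: Ck_on_cst]. Qed.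

Lemma smooth_germ_mxP (a b : nat) (f : 'rV[R]_n -> 'M[R]_(a, b)) :
  smooth_germ f <-> forall i j, smooth_germ (fun x => f x i j : R).
Proof.
split=> [[U [oU U0 Cf]] i j|Cf].
  by exists U; split=> // k; exact: (Ck_on_mxP _ _ oU).1 (Cf k) i j.
have {}Cf : \forall e \near (0 : R)^'+, forall i j k,
    Ck_on (ball (0 : 'rV[R]_n) e) k (fun x => f x i j : R).
  apply: filter_forall => i; apply: filter_forall => j.
  exact: (smooth_germP _).1 (Cf i j).
apply/smooth_germP; apply: filterS Cf => e Cf k.
by apply/Ck_on_mxP; [exact: ball_open | move=> i j; exact: Cf].
Qed.

Lemma smooth_germD (W : normedModType R) (f g : 'rV[R]_n -> W) :
  smooth_germ f -> smooth_germ g -> smooth_germ (fun x => f x + g x).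
Proof.
move=> /smooth_germP Cf /smooth_germP Cg; apply/smooth_germP.
near=> e => k; apply: Ck_onD; first exact: ball_open.
  exact: (near Cf e).
exact: (near Cg e).
Unshelve. all: by end_near. Qed.

Lemma smooth_germN (W : normedModType R) (f : 'rV[R]_n -> W) :
  smooth_germ f -> smooth_germ (fun x => - f x).
Proof.
by move=> [U [oU U0 Cf]]; exists U; split=> // k; exact: Ck_onN.
Qed.

Lemma smooth_germ_mulmx (a b c : nat) (f : 'rV[R]_n -> 'M[R]_(a, b))
    (g : 'rV[R]_n -> 'M[R]_(b, c)) :
  smooth_germ f -> smooth_germ g -> smooth_germ (fun x => f x *m g x).
Proof.
move=> /smooth_germP Cf /smooth_germP Cg; apply/smooth_germP.
near=> e => k; apply: Ck_on_mulmx; first exact: ball_open.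
  exact: (near Cf e).
exact: (near Cg e).
Unshelve. all: by end_near. Qed.

Lemma smooth_germ_invmx (a : nat) (f : 'rV[R]_n -> 'M[R]_a) :
  (\forall x \near (0 : 'rV[R]_n), f x \in unitmx) ->
  smooth_germ f -> smooth_germ (fun x => invmx (f x)).
Proof.
move=> /nbhs_ball0 fu /smooth_germP Cf; apply/smooth_germP.
near=> e => k; apply: Ck_on_invmx; first exact: ball_open.
  by move=> x; exact: (near fu e).
exact: (near Cf e).
Unshelve. all: by end_near. Qed.

Lemma smooth_germ_unitmx (a : nat) (f : 'rV[R]_n -> 'M[R]_a) :
  smooth_germ f -> f 0 \in unitmx ->
  \forall x \near (0 : 'rV[R]_n), f x \in unitmx.
Proof.
move=> [U [oU U0 Cf]]; rewrite unitmxE unitfE => f0.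
have cdet : {for 0, continuous (fun x => \det (f x))}.
  apply: Ck_on_continuous U0; apply: Ck_on_det => //.
  exact: (Ck_on_mxP _ _ oU).1 (Cf 0%N).
by near=> x; rewrite unitmxE unitfE; near: x; exact: (cvgr_neq0 _ cdet).
Unshelve. all: by end_near. Qed.

Lemma smooth_germ_coord (j : 'I_n) : smooth_germ (fun x : 'rV[R]_n => x ord0 j : R).
Proof.
by exists setT; split=> // [|k]; [exact: openT | exact: Ck_on_coord].
Qed.

Lemma smooth_germ_id : smooth_germ (fun x : 'rV[R]_n => x).
Proof.
apply/smooth_germ_mxP => i j; rewrite (ord1 i); exact: smooth_germ_coord.
Qed.

End SmoothGerms.

Lemma smooth_germ_comp (R : realType) (m n a b : nat)
    (f : 'rV[R]_n -> 'M[R]_(a, b)) (g : 'rV[R]_m -> 'rV[R]_n) :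
  smooth_germ f -> smooth_germ g -> g 0 = 0 -> smooth_germ (fun x => f (g x)).
Proof.
move=> [U [oU U0 Cf]] Cg g0; apply/smooth_germP.
have /nbhs_ball0 gU : \forall x \near (0 : 'rV[R]_m), U (g x).
  have cg := smooth_germ_continuous Cg.
  by apply: cg; rewrite /= g0; exact: open_nbhs_nbhs.
move/smooth_germP: Cg => Cg.
near=> e => k; apply: (@Ck_on_comp_mx _ _ _ _ _ _ U) => //.
- exact: ball_open.
- exact: (near gU e).
- exact: (near Cg e).
Unshelve. all: by end_near. Qed.

Lemma near0_comp (R : realType) (m n : nat) (g : 'rV[R]_m -> 'rV[R]_n)
    (P : 'rV[R]_n -> Prop) : {for 0, continuous g} -> g 0 = 0 ->
  (\forall y \near (0 : 'rV[R]_n), P y) ->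
  \forall x \near (0 : 'rV[R]_m), P (g x).
Proof. by move=> cg g0 P0; apply: (cg P); rewrite /= g0. Qed.

(** * The inverse function theorem *)

Section MatrixNorm.
Variable R : realType.

Lemma coord_le_norm (a b : nat) (M : 'M[R]_(a, b)) i j : `|M i j| <= `|M|.
Proof.
rewrite [leRHS]/Num.Def.normr/= mx_normrE.
exact: (le_bigmax _ (fun ij : 'I_a * 'I_b => `|M ij.1 ij.2|) (i, j)).
Qed.

Lemma norm_mx_le (a b : nat) (M : 'M[R]_(a, b)) c : 0 <= c ->
  (forall i j, `|M i j| <= c) -> `|M| <= c.
Proof.
move=> c0 Mc; rewrite [leLHS]/Num.Def.normr/= mx_normrE.
by apply: (bigmax_le _ c0) => -[i j] _; exact: Mc.
Qed.

(** The norm is the largest absolute value of the entries, and an entry of the product is a sum of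
    [b] terms; hence the factor [b]. *)
Lemma norm_mulmx_le (a b c : nat) (M : 'M[R]_(a, b)) (N : 'M[R]_(b, c)) :
  `|M *m N| <= b%:R * (`|M| * `|N|).
Proof.
apply: norm_mx_le => [|i j]; first by rewrite !mulr_ge0.
rewrite mxE (le_trans (ler_norm_sum _ _ _))// mulr_natl -[X in _ *+ X]card_ord.
rewrite -sumr_const ler_sum // => k _.
by rewrite normrM ler_pM // coord_le_norm.
Qed.

Lemma mulmxr_continuous (b c : nat) (N : 'M[R]_(b, c)) :
  continuous (fun v : 'rV[R]_b => v *m N).
Proof.
have C0 : Ck_on setT 0 (fun v : 'rV[R]_b => v *m N).
  apply: Ck_on_mulmx; [exact: openT| |exact: Ck_on_cst].
  apply/Ck_on_mxP; first exact: openT.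
  by move=> i j; rewrite (ord1 i); exact: Ck_on_coord.
by move=> v; exact: C0.
Qed.

End MatrixNorm.

(** * Mean value inequality on a ball *)

Section MeanValue.
Variables (R : realType) (n : nat).

Lemma is_derive_segment (f : 'rV[R]_n -> R) (x h : 'rV[R]_n) (t : R) :
  differentiable f (x + t *: h) ->
  is_derive t 1 (fun s => f (x + s *: h)) ('D_h f (x + t *: h)).
Proof.
move=> df; pose l := fun s : R => x + s *: h.
have dl : is_diff t l (0 + ( *:%R^~ h)).
  exact: (is_diffD (is_diff_cst x t) (is_diff_scalel t h)).
have dlt : differentiable l t by exact: ex_diff.
have dfl : differentiable (f \o l) t by exact: differentiable_comp.
apply: DeriveDef; first exact: diff_derivable.
rewrite deriveE // (diff_comp dlt df) /= deriveE //; congr ('d f _ _).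
have -> : 'd l t = 0 + *:%R^~ h :> (R -> 'rV[R]_n) by exact: diff_val.
by rewrite fctE /= add0r scale1r.
Qed.

Lemma segment_MVT (f : 'rV[R]_n -> R) (x h : 'rV[R]_n) :
  (forall t, 0 <= t <= 1 -> differentiable f (x + t *: h)) ->
  exists2 t, 0 <= t <= 1 & f (x + h) - f x = 'D_h f (x + t *: h).
Proof.
move=> df; have dd t : 0 <= t <= 1 -> _ := fun t01 => is_derive_segment (df t t01).
have [||c] := @MVT_segment R (fun t => f (x + t *: h))
  (fun t => 'D_h f (x + t *: h)) 0 1 ler01.
- by move=> t; rewrite in_itv /= => /andP[t0 t1]; apply: dd; rewrite !ltW.
- apply: derivable_within_continuous => t; rewrite in_itv /= => t01.
  by have [] := dd t t01.
- rewrite in_itv /= => c01; rewrite scale1r scale0r addr0 subr0 mulr1 => E.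
  by exists c.
Qed.

Lemma ball0_convex (r : R) (x y : 'rV[R]_n) t : 0 <= t <= 1 ->
  ball 0 r x -> ball 0 r y -> ball 0 r (x + t *: (y - x)).
Proof.
rewrite -!ball_normE /= !sub0r !normrN => /andP[t0 t1] xr yr.
have -> : x + t *: (y - x) = t *: y + (1 - t) *: x.
  by rewrite scalerBr scalerBl scale1r addrCA.
rewrite (le_lt_trans (ler_normD _ _))// !normrZ (ger0_norm t0).
rewrite (@ger0_norm _ (1 - t)) ?subr_ge0 //.
(* The case [t = 0] is set apart because the strict bound on [y] stays strict only when multiplied
   by a positive [t]. *)
have [->|t0'] := eqVneq t 0; first by rewrite mul0r add0r subr0 mul1r.
have tpos : 0 < t by rewrite lt_neqAle eq_sym t0'.
have := ltr_pM2l tpos `|y| r; rewrite yr => ty.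
have : (1 - t) * `|x| <= (1 - t) * r by rewrite ler_wpM2l ?subr_ge0 // ltW.
by move: ty; nra.
Qed.

(** The increment is a derivative along [y - x] at a point of the segment, hence a combination of
    [n] partial derivatives with coefficients at most [|y - x|]. *)
Lemma mean_value_ineq (f : 'rV[R]_n -> R) (r c : R) :
  (forall x, ball 0 r x -> differentiable f x) ->
  (forall x j, ball 0 r x -> `|'D_(delta_mx ord0 j) f x| <= c) ->
  forall x y, ball 0 r x -> ball 0 r y -> `|f y - f x| <= n%:R * (`|y - x| * c).
Proof.
move=> df Df x y xr yr.
have [|t t01] := @segment_MVT f x (y - x).
  by move=> t t01; apply: df; exact: ball0_convex.
rewrite (addrC x) subrK => ->; have tr := ball0_convex t01 xr yr.
rewrite derive_sum_delta; last exact: df.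
rewrite (le_trans (ler_norm_sum _ _ _))// mulr_natl -[X in _ *+ X]card_ord.
rewrite -sumr_const ler_sum // => j _.
by rewrite normrM ler_pM ?coord_le_norm // Df.
Qed.

End MeanValue.

(** Points are row vectors, so this is the transpose of the usual Jacobian matrix and acts on
    directions from the right. *)
Definition jac (R : realType) (m n : nat) (f : 'rV[R]_m -> 'rV[R]_n)
    (x : 'rV[R]_m) : 'M[R]_(m, n) :=
  \matrix_(i, j) 'D_(delta_mx ord0 i) f x ord0 j.

Lemma derive_jac (R : realType) (m n : nat) (f : 'rV[R]_m -> 'rV[R]_n) x v :
  differentiable f x -> 'D_v f x = v *m jac f x.
Proof.
move=> df; rewrite derive_sum_delta //; apply/rowP => j.
by rewrite summxE !mxE; apply: eq_bigr => i _; rewrite !mxE.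
Qed.

Lemma Ck_on_jac (R : realType) (m n : nat) (f : 'rV[R]_m -> 'rV[R]_n) U k :
  open U -> Ck_on U k.+1 f -> Ck_on U k (jac f).
Proof.
move=> oU Cf; apply/Ck_on_mxP => // i j.
apply: Ck_on_ext ((Ck_on_mxP _ _ oU).1 (Cf.2 (delta_mx ord0 i)) ord0 j) => //.
by move=> x _; rewrite mxE.
Qed.

Lemma smooth_germ_jac (R : realType) (m n : nat) (f : 'rV[R]_m -> 'rV[R]_n) :
  smooth_germ f -> smooth_germ (jac f).
Proof.
by move=> [U [oU U0 Cf]]; exists U; split=> // k; exact: Ck_on_jac.
Qed.

(** * Local inversion of a map close to the identity *)

Section InverseFunction.
Variables (R : realType) (n : nat) (f : 'rV[R]_n -> 'rV[R]_n) (e : R).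
Hypothesis e_gt0 : 0 < e.
Hypothesis f0 : f 0 = 0.
Hypothesis Cf : forall k, Ck_on (ball 0 e) k f.
Hypothesis f_unit : forall x, ball 0 e x -> jac f x \in unitmx.
Hypothesis f_id : forall x y, ball 0 e x -> ball 0 e y ->
  `|(y - f y) - (x - f x)| <= `|y - x| / 2.

(** With half the radius, the closed ball [B] on which the fixed point theorem is applied lies in
    the open ball of the hypotheses. *)
Let r := e / 2.
Let B : set 'rV[R]_n := closed_ball_ Num.norm 0 r.

Local Lemma ball_B x : B x -> ball 0 e x.
Proof.
rewrite -ball_normE /B /closed_ball_ /= => xr; apply: le_lt_trans xr _.
by rewrite ltr_pdivrMr // mulr_natr mulr2n ltrDl.
Qed.

Local Lemma B0 : B 0.
Proof. by rewrite /B /closed_ball_ /= subr0 normr0 divr_ge0 // ltW. Qed.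

(** The difference [y - x] is the increment of [f] plus that of the identity minus [f], and the
    latter is at most half of [|y - x|]. Both the injectivity of [f] and the Lipschitz bound for its
    inverse come from here. *)
Local Lemma dist_le x y : ball 0 e x -> ball 0 e y ->
  `|y - x| <= 2 * `|f y - f x|.
Proof.
move=> xe ye; have := f_id xe ye.
have E : y - x = f y - f x + ((y - f y) - (x - f x)).
  by rewrite opprB addrACA addKr subrKC.
have := ler_normD (f y - f x) (y - f y - (x - f x)); rewrite -E; lra.
Qed.

(** The solutions are the fixed points of [T], a contraction of factor 1/2 that preserves [B]: both
    [y] and [x - f x] have norm at most [r / 2]. *)
Local Lemma fixpoint y : `|y| <= r / 2 -> exists2 x, B x & f x = y.
Proof.
move=> yr; pose T x := y + (x - f x).
have TB : {homo T : x / B x >-> B x}.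
  move=> x Bx; have := f_id (ball_B B0) (ball_B Bx).
  rewrite f0 !subr0 => h; move: Bx; rewrite /B /closed_ball_ /= !sub0r !normrN.
  move=> xr; rewrite (le_trans (ler_normD _ _))// [leRHS](splitr r) lerD //.
  by rewrite (le_trans h) // ler_wpM2r.
pose X : completeNormedModType R :=
  HB.pack 'rV[R]_n (Uniform_isComplete.Build 'rV[R]_n (@cauchy_cvg 'rV[R]_n)).
have [| | |p Bp pT] := @banach_fixed_point R X B (mkfun_fun TB).
- exists (2^-1)%:nng; split; first by rewrite /= invf_lt1 // ltr1n.
  move=> [x x'] [Bx Bx'] /=.
  suff : `|T x - T x'| <= 2^-1 * `|x - x'| by [].
  rewrite /T opprD addrACA subrr add0r mulrC.
  exact: f_id (ball_B Bx') (ball_B Bx).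
- exact: closed_closed_ball_.
- by exists 0; exact: B0.
exists p => //; have {}pT : p = y + (p - f p) by [].
apply/esym/subr0_eq.
have -> : y - f p = y + (p - f p) - p by rewrite addrCA addrAC subrr add0r.
by rewrite -pT subrr.
Qed.

(** A choice of the solution given by [fixpoint]; the default 0 is taken only at points [y] with no
    solution in [B], all outside [V]. *)
Let g y : 'rV[R]_n := xget 0 [set x | B x /\ f x = y].

Local Lemma gP y : `|y| <= r / 2 -> B (g y) /\ f (g y) = y.
Proof.
move=> /fixpoint[x Bx fx].
by apply: (@xgetPex _ 0 [set x | B x /\ f x = y]); exists x.
Qed.

Let V : set 'rV[R]_n := ball 0 (r / 2).

Local Lemma V_le y : V y -> `|y| <= r / 2.
Proof. by rewrite /V -ball_normE /= sub0r normrN => /ltW. Qed.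

Local Lemma g_lip y y' : V y -> V y' -> `|g y' - g y| <= 2 * `|y' - y|.
Proof.
move=> /V_le/gP[By fy] /V_le/gP[By' fy'].
by rewrite -{2}fy -{2}fy'; apply: dist_le; exact: ball_B.
Qed.

Local Lemma oV : open V. Proof. exact: ball_open. Qed.

Local Lemma oE : open (ball (0 : 'rV[R]_n) e). Proof. exact: ball_open. Qed.

(** The first-order expansion of [f] at [g y] is read backwards: its remainder is small relative to
    the increment [k] of [g], and [k] is at most twice the increment [h] of [y]. *)
Local Lemma g_diff y : V y -> differentiable g y /\
  forall v, 'D_v g y = v *m invmx (jac f (g y)).
Proof.
move=> Vy; have [By fy] := gP (V_le Vy).
set P := g y; set N := invmx (jac f P).
have dfP : differentiable f P by exact: (Cf 1).1 (ball_B By).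
pose L : {linear 'rV[R]_n -> 'rV[R]_n} := mulmxr N.
suff [dg gL] : differentiable g y /\ 'd g y = L :> (_ -> _).
  by split=> // v; rewrite deriveE // gL.
apply: differentiable_dist => [|d d0]; first exact: mulmxr_continuous.
pose c := n%:R * `|N|; have c0 : 0 <= c by rewrite mulr_ge0.
have c1 : 0 < c + 1 by rewrite ltr_wpDl.
(* The factor 2 absorbs the Lipschitz constant of [g] and [c] the multiplication by [N]; [c + 1]
   replaces [c] to be positive. *)
have d1 : 0 < d / (2 * (c + 1)) by rewrite divr_gt0 // mulr_gt0.
have /nbhs_normP[del /= del0 Hdel] := dist_differentiable dfP d1.
have yV : \forall h \near (0 : 'rV[R]_n), V (h + y).
  have : \forall z \near y, V z by apply: near_open oV Vy _.
  by rewrite (near_shift 0) subr0.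
have hdel : \forall h \near (0 : 'rV[R]_n), `|h| < del / 2.
  by apply: nbhs0_lt; rewrite divr_gt0.
near=> h.
have Vh : V (h + y) by near: h.
have hd : `|h| < del / 2 by near: h.
have [Bh fh] := gP (V_le Vh).
set k := g (h + y) - P.
have kh : `|k| <= 2 * `|h| by have := g_lip Vy Vh; rewrite addrK.
have kdel : `|k| < del.
  by rewrite (le_lt_trans kh) // mulrC -ltr_pdivlMr.
have := Hdel k; rewrite /ball_ /= sub0r normrN => /(_ kdel).
rewrite /k subrK fh fy addrK -/k -deriveE // derive_jac // => hk.
(* The error of the candidate [L] is, up to sign, the remainder of [f] at [P] multiplied by [N]. *)
have -> : k - L h = - ((h - k *m jac f P) *m N).
  rewrite /L /= mulmxBl mulmxK ?opprB //; exact/f_unit/ball_B.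
rewrite normrN (le_trans (norm_mulmx_le _ _)) //.
rewrite mulrCA -/c (le_trans (ler_wpM2r c0 hk)) //.
have := ler_wpM2l (ltW d1) kh; set u := d / _ => ku.
have -> : d * `|h| = u * (2 * `|h|) * (c + 1).
  by rewrite /u; field; rewrite gt_eqF.
rewrite (le_trans (ler_wpM2r c0 ku)) // ler_wpM2l ?lerDl //.
by apply: mulr_ge0; [exact: ltW|rewrite mulr_ge0].
Unshelve. all: by end_near. Qed.

(** The formula for the derivative involves [g] only through [jac f \o g], so each order of
    regularity of [g] yields the next one. *)
Local Lemma gC k : Ck_on V k g.
Proof.
elim: k => [|k IH]; first by move=> y /g_diff[/differentiable_continuous].
split=> [y /g_diff[] //|v].
apply: (@Ck_on_ext _ _ _ _ _ (fun y => v *m invmx ((jac f \o g) y))).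
- exact: oV.
- by move=> y /g_diff[_ ->].
have Vg y : V y -> ball 0 e (g y) by move=> /V_le/gP[/ball_B].
apply: Ck_on_mulmx; [exact: oV|exact: Ck_on_cst|].
apply: Ck_on_invmx; [exact: oV|by move=> y /Vg/f_unit|].
apply: Ck_on_comp_mx IH; [exact: oV|exact: oE|exact: Vg|].
by apply: Ck_on_jac; [exact: oE|exact: Cf].
Qed.

Lemma inverse_germ : exists g, diffeo_germ f g.
Proof.
have r2 : 0 < r / 2 by rewrite !divr_gt0.
have e0 : ball (0 : 'rV[R]_n) e 0 by exact: ballxx.
have V0 : V 0 by exact: ballxx.
exists g; split.
- by split=> //; exists (ball 0 e); split=> //; exact: oE.
- split; first by exists V; split; [exact: oV|exact: V0|exact: gC].
  have [B0' f0'] := gP (V_le V0).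
  have := dist_le e0 (ball_B B0').
  by rewrite f0' f0 !subr0 normr0 mulr0 normr_le0 => /eqP.
- have fV : \forall x \near (0 : 'rV[R]_n), V (f x).
    have cf : {for 0, continuous f} by exact: Ck_on_continuous (Cf 0) e0.
    by apply: cf; rewrite f0; exact: nbhsx_ballx.
  have xe : \forall x \near (0 : 'rV[R]_n), ball 0 e x by exact: nbhsx_ballx.
  near=> x.
  have Vx : V (f x) by near: x.
  have ex : ball 0 e x by near: x.
  have [Bx fx] := gP (V_le Vx).
  have := dist_le ex (ball_B Bx).
  by rewrite fx subrr normr0 mulr0 normr_le0 subr_eq0 => /eqP.
- by apply: near_open oV V0 _ => y /V_le/gP[].
Unshelve. all: by end_near. Qed.

End InverseFunction.

Lemma jac_mulmxr (R : realType) (m n p : nat) (f : 'rV[R]_m -> 'rV[R]_n)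
    (N : 'M[R]_(n, p)) x : differentiable f x ->
  differentiable (fun y => f y *m N) x /\
  jac (fun y => f y *m N) x = jac f x *m N.
Proof.
move=> df.
have dN z : differentiable (mulmxr N : 'rV[R]_n -> 'rV[R]_p) z.
  by apply: linear_differentiable; exact: mulmxr_continuous.
have dfN : differentiable (mulmxr N \o f) x by exact: differentiable_comp.
split=> //; apply/row_matrixP => i; rewrite !rowE mulmxA -!derive_jac //.
rewrite [LHS]deriveE //; transitivity ('d (mulmxr N \o f) x (delta_mx 0 i)) => //.
rewrite (diff_comp df (dN _)) /= diff_lin; last exact: mulmxr_continuous.
by rewrite /= deriveE.
Qed.

(** After multiplication by [N] the Jacobian at 0 is the identity, so the identity minus [F] has
    small partial derivatives near 0 and is a contraction on a small ball. *)
Theorem inverse_function (R : realType) (n : nat) (f : 'rV[R]_n -> 'rV[R]_n) :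
  smooth_germ f -> f 0 = 0 -> jac f 0 \in unitmx -> exists g, diffeo_germ f g.
Proof.
move=> Sf f0 Jf; pose N := invmx (jac f 0).
pose F x := f x *m N.
have SN (h : 'rV[R]_n -> 'rV[R]_n) M : smooth_germ h -> smooth_germ (fun x => h x *m M).
  by move=> Sh; apply: smooth_germ_mulmx => //; exact: smooth_germ_cst.
have SF : smooth_germ F by exact: SN.
have F0 : F 0 = 0 by rewrite /F f0 mul0mx.
have JF : jac F 0 = 1%:M.
  have [_ ->] := jac_mulmxr N (smooth_germ_differentiable0 Sf).
  by rewrite mulmxV.
(* The mean value inequality costs a factor [n], and [n * c <= 1 / 2]; the successor keeps [c]
   positive when [n = 0]. *)
pose c : R := (2 * n.+1%:R)^-1.
have c0 : 0 < c by rewrite invr_gt0 mulr_gt0 // ltr0n.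
have SJ := smooth_germ_jac SF.
have JU : \forall x \near (0 : 'rV[R]_n), jac F x \in unitmx.
  by apply: smooth_germ_unitmx SJ _; rewrite JF unitmx1.
have JB : \forall x \near (0 : 'rV[R]_n), `|1%:M - jac F x| < c.
  have cJ := smooth_germ_continuous SJ.
  by move/cvgrPdist_lt : cJ => /(_ _ c0); rewrite JF.
have /smooth_germP Ck := SF.
have /nbhs_ball0 JU' := JU; have /nbhs_ball0 JB' := JB.
near (0 : R)^'+ => e.
have e0 : 0 < e by near: e; exact: nbhs_right_gt.
have CF : forall k, Ck_on (ball 0 e) k F by near: e.
have UF : ball 0 e `<=` (fun x => jac F x \in unitmx) by near: e.
have BF : ball 0 e `<=` (fun x => `|1%:M - jac F x| < c) by near: e.
have [] := @inverse_germ R n F e e0 F0 CF UF.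
  move=> x y ex ey; apply: norm_mx_le => [|i j]; first by rewrite divr_ge0.
  rewrite (ord1 i) => {i}.
  have dF z : ball 0 e z -> differentiable F z by exact: (CF 1).1.
  have dc z : differentiable (fun x : 'rV[R]_n => x ord0 j : R) z.
    exact: differentiable_coord.
  pose u := fun z : 'rV[R]_n => z ord0 j - F z ord0 j : R.
  have dFj z : ball 0 e z -> differentiable (fun x => F x ord0 j : R) z.
    by move=> /dF/differentiable_mxP; exact.
  have du z : ball 0 e z -> differentiable u z.
    by move=> ez; apply: differentiableB => //; exact: dFj.
  have Du z i : ball 0 e z -> `|'D_(delta_mx ord0 i) u z| <= c.
    move=> ez.
    have -> : 'D_(delta_mx ord0 i) u z = (1%:M - jac F z) i j.
      rewrite [LHS]deriveB; [|exact: diff_derivable|exact/diff_derivable/dFj].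
      have Eid : 'D_(delta_mx ord0 i) (fun x : 'rV[R]_n => x ord0 j : R) z =
          'D_(delta_mx ord0 i) (id : 'rV[R]_n -> 'rV[R]_n) z ord0 j.
        exact: (@derive_coord _ _ _ _ id).
      rewrite (derive_coord _ _ _ (dF z ez)) Eid derive_id !mxE.
      by rewrite eqxx eq_sym.
    exact: le_trans (coord_le_norm _ _ _) (ltW (BF _ ez)).
  have := mean_value_ineq du Du ex ey.
  have -> : u y - u x = (y - F y - (x - F x)) ord0 j.
    by rewrite /u [RHS]mxE [in RHS]mxE; congr (_ + _); rewrite !mxE.
  move=> h; rewrite (le_trans h) // mulrCA ler_wpM2l // /c invfM mulrCA.
  by rewrite ger_pMr // ler_pdivrMr ?ltr0n // mul1r ler_nat.
move=> g [_ [Sg g0] gF Fg].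
have NJ : N *m jac f 0 = 1%:M by rewrite mulVmx.
have cN : {for 0, continuous (fun y : 'rV[R]_n => y *m N)} by exact: mulmxr_continuous.
(* [g] inverts [f] followed by [N], so [N] followed by [g] inverts [f]. *)
exists (fun y => g (y *m N)); split=> //.
- split; last by rewrite mul0mx.
  apply: (@smooth_germ_comp _ _ _ _ _ g) => //; last by rewrite mul0mx.
  by apply: SN; exact: smooth_germ_id.
(* Both sides carry a right factor [N], which multiplication by [jac f 0] cancels. *)
- have : \forall y \near (0 : 'rV[R]_n), F (g (y *m N)) = y *m N.
    by apply: (near0_comp cN) Fg; rewrite mul0mx.
  by apply: filterS => y /(congr1 (mulmx^~ (jac f 0))); rewrite /F -!mulmxA NJ !mulmx1.
Unshelve. all: by end_near. Qed.

(** * Hadamard's lemma *)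

Section UnitIntegral.
Variable R : realType.
Implicit Types f g : R -> R.

Definition unit_integral f : R := \int[lebesgue_measure]_(s in `[0, 1]) f s.

(** Two-sided continuity, at the endpoints too, so that the limit rules apply pointwise; continuity
    within the interval, as integration asks, follows. *)
Definition unit_continuous f := forall s, 0 <= s <= 1 -> {for s, continuous f}.

Lemma unit_continuous_within f :
  unit_continuous f -> {within `[0, 1], continuous f}.
Proof.
move=> cf; apply: continuous_in_subspaceT => s; rewrite inE /= in_itv /=.
exact: cf.
Qed.

Lemma unit_continuous_integrable f : unit_continuous f ->
  lebesgue_measure.-integrable `[0, 1] (EFin \o f).
Proof.
move=> /unit_continuous_within cf.
by apply: continuous_compact_integrable => //; exact: segment_compact.
Qed.

Lemma unit_integralD f g : unit_continuous f -> unit_continuous g ->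
  unit_integral (fun s => f s + g s) = unit_integral f + unit_integral g.
Proof.
by move=> cf cg; apply: RintegralD => //; exact: unit_continuous_integrable.
Qed.

Lemma unit_integralB f g : unit_continuous f -> unit_continuous g ->
  unit_integral (fun s => f s - g s) = unit_integral f - unit_integral g.
Proof.
by move=> cf cg; apply: RintegralB => //; exact: unit_continuous_integrable.
Qed.

Lemma unit_integralZ f c : unit_continuous f ->
  unit_integral (fun s => c * f s) = c * unit_integral f.
Proof. by move=> cf; apply: RintegralZl => //; exact: unit_continuous_integrable. Qed.

Lemma unit_integral_cst c : unit_integral (fun=> c) = c.
Proof.
rewrite /unit_integral Rintegral_cst //= lebesgue_measure_itv /= lte_fin ltr01.
by rewrite /= subr0 mulr1.
Qed.

Lemma eq_unit_integral f g : (forall s, 0 <= s <= 1 -> f s = g s) ->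
  unit_integral f = unit_integral g.
Proof.
by move=> fg; apply: eq_Rintegral => s; rewrite inE /= in_itv /=; exact: fg.
Qed.

Lemma unit_integral_le f c : unit_continuous f ->
  (forall s, 0 <= s <= 1 -> `|f s| <= c) -> `|unit_integral f| <= c.
Proof.
move=> cf fc; have If := unit_continuous_integrable cf.
rewrite (le_trans (le_normr_Rintegral _ If)) // -[leRHS]unit_integral_cst.
apply: le_Rintegral => //.
- by apply: unit_continuous_integrable => s s01; apply: cvg_norm; exact: cf.
- by apply: unit_continuous_integrable => s _; exact: cvg_cst.
Qed.

Lemma unit_continuous_sum (I : Type) (r : seq I) (f : I -> R -> R) :
  (forall i, unit_continuous (f i)) ->
  unit_continuous (fun s => \sum_(i <- r) f i s).
Proof.
move=> cf; elim: r => [|i r IH].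
  have -> : (fun s => \sum_(i <- [::]) f i s) = (fun=> 0).
    by apply/funext => s; rewrite big_nil.
  by move=> s _; exact: cvg_cst.
have -> : (fun s => \sum_(j <- i :: r) f j s) =
    (fun s => f i s + \sum_(j <- r) f j s).
  by apply/funext => s; rewrite big_cons.
by move=> s s01; exact: (cvgD (cf i s s01) (IH s s01)).
Qed.

Lemma unit_integral_sum (I : Type) (r : seq I) (f : I -> R -> R) :
  (forall i, unit_continuous (f i)) ->
  unit_integral (fun s => \sum_(i <- r) f i s) = \sum_(i <- r) unit_integral (f i).
Proof.
move=> cf; elim: r => [|i r IH].
  rewrite big_nil -[RHS]unit_integral_cst.
  by apply: eq_unit_integral => s _; rewrite big_nil.
rewrite big_cons -IH -unit_integralD //; last exact: unit_continuous_sum.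
by apply: eq_unit_integral => s _; rewrite big_cons.
Qed.

Lemma unit_integral_FTC f (F : R -> R) : unit_continuous f ->
  (forall s : R, 0 <= s <= 1 -> is_derive s (1 : R) F (f s)) ->
  unit_integral f = F 1 - F 0.
Proof.
move=> cf dF.
have cF s : 0 <= s <= 1 -> {for s, continuous F}.
  by move=> /dF[dFs _]; exact/differentiable_continuous/derivable1_diffP.
have s0 : 0 <= (0 : R) <= 1 by rewrite lexx ler01.
have s1 : 0 <= (1 : R) <= 1 by rewrite lexx ler01.
rewrite /unit_integral /Rintegral (@continuous_FTC2 _ f F) //.
- exact: unit_continuous_within.
- split.
  + by move=> s; rewrite in_itv /= => /andP[a b]; have [] := dF s; rewrite ?ltW.
  + exact: cvg_at_right_filter (cF 0 s0).
  + exact: cvg_at_left_filter (cF 1 s1).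
- move=> s; rewrite in_itv /= => /andP[a b]; rewrite derive1E.
  by have [] := dF s; rewrite ?ltW.
Qed.

End UnitIntegral.

Lemma linear_rV_continuous (R : realType) (n : nat) (L : {linear 'rV[R]_n -> R}) :
  continuous L.
Proof.
have C0 : Ck_on setT 0 (fun v : 'rV[R]_n => \sum_j v ord0 j * L (delta_mx ord0 j)).
  apply: Ck_on_sum; first exact: openT.
  move=> j _; apply: Ck_onM; [exact: openT|exact: Ck_on_coord|exact: Ck_on_cst].
move=> v; have := C0 v I.
rewrite (_ : (fun v => _) = L) //; apply/funext => w.
by rewrite [in RHS](row_sum_delta w) linear_sum; apply: eq_bigr => j _; rewrite linearZ.
Qed.

(** * Dilation of the last [k] coordinates *)

Section Dilation.
Variables (R : realType) (m k : nat).
Notation V := 'rV[R]_(m + k).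

Definition lproj (x : V) : V := row_mx (lsubmx x) 0.
Definition rproj (x : V) : V := row_mx 0 (rsubmx x).
(** This is [(y, z) |-> (y, s z)], written as an affine function of [s] so that [is_derive_segment]
    differentiates along it. *)
Definition dil (s : R) (x : V) : V := lproj x + s *: rproj x.

Lemma lproj_linear : linear lproj.
Proof.
move=> a x y; rewrite /lproj linearP /= scale_row_mx add_row_mx.
by rewrite scaler0 addr0.
Qed.

Lemma rproj_linear : linear rproj.
Proof.
move=> a x y; rewrite /rproj linearP /= scale_row_mx add_row_mx.
by rewrite scaler0 addr0.
Qed.

Lemma dilE s x : dil s x = row_mx (lsubmx x) (s *: rsubmx x).
Proof. by rewrite /dil /lproj /rproj scale_row_mx add_row_mx scaler0 addr0 add0r. Qed.

Lemma dil1 x : dil 1 x = x.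
Proof. by rewrite dilE scale1r hsubmxK. Qed.

Lemma dil0l x : dil 0 x = lproj x.
Proof. by rewrite /dil scale0r addr0. Qed.

Lemma dil_linear s : linear (dil s).
Proof.
move=> a x y; rewrite /dil lproj_linear rproj_linear.
by rewrite scalerDr scalerDr !scalerA (mulrC s) addrACA.
Qed.

Lemma dil0 s : dil s 0 = 0.
Proof. by rewrite dilE !linear0 row_mx0. Qed.

Lemma dilD s x y : dil s (x + y) = dil s x + dil s y.
Proof. by have := dil_linear s 1 x y; rewrite !scale1r. Qed.

Lemma dilZ s a x : dil s (a *: x) = a *: dil s x.
Proof. by have := dil_linear s a x 0; rewrite dil0 !addr0. Qed.

(** No coordinate grows in absolute value. Balls around 0 are therefore stable, and a mean over [s]
    stays in the domain of [f]. *)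
Lemma norm_dil s x : 0 <= s <= 1 -> `|dil s x| <= `|x|.
Proof.
move=> /andP[s0 s1]; apply: norm_mx_le => // i j; rewrite dilE.
case: (split_ordP j) => a ->.
  by rewrite row_mxEl mxE coord_le_norm.
rewrite row_mxEr mxE [rsubmx _ _ _]mxE normrM (ger0_norm s0).
rewrite (le_trans _ (coord_le_norm x i (rshift m a))) //.
by rewrite ler_piMl.
Qed.

Lemma ball_dil r s x : 0 <= s <= 1 -> ball 0 r x -> ball 0 r (dil s x).
Proof.
move=> s01; rewrite -!ball_normE /= !sub0r !normrN; apply: le_lt_trans.
exact: norm_dil.
Qed.

Lemma rproj_cont : continuous rproj.
Proof.
suff C0 : Ck_on setT 0 rproj by move=> x; exact: C0.
apply/Ck_on_mxP; first exact: openT.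
move=> i j; rewrite (ord1 i) /rproj.
case: (split_ordP j) => a ->.
  apply: (@Ck_on_ext _ _ _ _ _ (fun=> 0 : R)); [exact: openT| |exact: Ck_on_cst].
  by move=> x _; rewrite row_mxEl mxE.
apply: (@Ck_on_ext _ _ _ _ _ (fun x => x ord0 (rshift m a) : R)).
- exact: openT.
- by move=> x _; rewrite row_mxEr mxE.
- exact: Ck_on_coord.
Qed.

Lemma lproj_cont : continuous lproj.
Proof.
suff C0 : Ck_on setT 0 lproj by move=> x; exact: C0.
apply/Ck_on_mxP; first exact: openT.
move=> i j; rewrite (ord1 i) /lproj.
case: (split_ordP j) => a ->.
  apply: (@Ck_on_ext _ _ _ _ _ (fun x => x ord0 (lshift k a) : R)).
  - exact: openT.
  - by move=> x _; rewrite row_mxEl mxE.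
  - exact: Ck_on_coord.
apply: (@Ck_on_ext _ _ _ _ _ (fun=> 0 : R)); [exact: openT| |exact: Ck_on_cst].
by move=> x _; rewrite row_mxEr mxE.
Qed.

Lemma dil_cont (x : V) (s : R) :
  {for (s, 0 : V), continuous (fun sh : R * V => dil sh.1 (sh.2 + x))}.
Proof.
have c2 : {for (s, 0 : V), continuous (fun sh : R * V => sh.2 + x)}.
  by apply: cvgD; [exact: cvg_snd | exact: cvg_cst].
have cl : {for (s, 0 : V), continuous (fun sh : R * V => lproj (sh.2 + x))}.
  by apply: (continuous_comp c2); exact: lproj_cont.
have cr : {for (s, 0 : V), continuous (fun sh : R * V => rproj (sh.2 + x))}.
  by apply: (continuous_comp c2); exact: rproj_cont.
have c1 : {for (s, 0 : V), continuous (fun sh : R * V => sh.1)}.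
  exact: cvg_fst.
exact: (cvgD cl (cvgZ c1 cr)).
Qed.

End Dilation.

(** * Weighted means along the dilations *)

Section Hadamard.
Variables (R : realType) (m k : nat) (r : R).
Hypothesis r0 : 0 < r.
Notation V := 'rV[R]_(m + k).
Let U : set V := ball 0 r.

Let oU : open U. Proof. exact: ball_open. Qed.

(** The weight is there for differentiation: a derivative of [f (y, s z)] in a direction of [z]
    brings out a factor [s], raising [p] by one. *)
Definition dil_mean (p : nat) (f : V -> R) (x : V) : R :=
  unit_integral (fun s => s ^+ p * f (dil s x)).

Local Lemma dil_unit_continuous (f : V -> R) p x : U x -> Ck_on U 0 f ->
  unit_continuous (fun s => s ^+ p * f (dil s x)).
Proof.
move=> Ux cf s s01.
have cd : {for s, continuous (fun t : R => dil t x)}.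
  have cs : {for s, continuous (fun t : R => t *: rproj x)}.
    exact: scalel_continuous.
  exact: (cvgD (cvg_cst _) cs).
have cfd : {for s, continuous (fun t : R => f (dil t x))}.
  by apply: (continuous_comp cd); apply: cf; exact: ball_dil.
have ce : {for s, continuous (fun t : R => t ^+ p)} by exact: exprn_continuous.
exact: (cvgM ce cfd).
Qed.

(** Joint continuity gives the bound near each parameter, and compactness of the unit interval makes
    it uniform in [s]. *)
Local Lemma dil_uniform (f : V -> R) x d : U x -> Ck_on U 0 f -> 0 < d ->
  \forall h \near (0 : V), forall s, 0 <= s <= 1 ->
    `|f (dil s (h + x)) - f (dil s x)| <= d.
Proof.
move=> Ux cf d0.
pose P (h : V) (s : R) : Prop := `|f (dil s (h + x)) - f (dil s x)| <= d.
have /compact_near_coveringP nc := @segment_compact R 0 1.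
suff /(nc V (nbhs (0 : V)) P _) : forall s : R, s \in `[0, 1] ->
    \forall s' \near s & h \near nbhs (0 : V), P h s'.
  by apply: filterS => h hP s s01; apply: hP; rewrite /= in_itv.
move=> s; rewrite in_itv /= => s01; rewrite /P.
have c1 : {for (s, 0 : V), continuous (fun sh : R * V => f (dil sh.1 (sh.2 + x)))}.
  apply: (continuous_comp (@dil_cont _ _ _ x s)).
  by apply: cf; rewrite /= add0r; exact: ball_dil.
have c2 : {for s, continuous (fun t => f (dil t x))}.
  have := @dil_unit_continuous f 0%N x Ux cf s s01.
  suff -> : (fun t => t ^+ 0 * f (dil t x)) = (fun t => f (dil t x)) by [].
  by apply/funext => t; rewrite expr0 mul1r.
have cfst : {for (s, 0 : V), continuous (fun sh : R * V => sh.1)}.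
  exact: cvg_fst.
have c3 : {for (s, 0 : V), continuous (fun sh : R * V => f (dil sh.1 x))}.
  exact: (continuous_comp cfst c2).
(* For parameters near [s], both values are compared with [f (dil s x)], each within half of [d]. *)
have d2 : 0 < d / 2 by rewrite divr_gt0.
have /= H1 := (cvgrPdist_lt _ _).1 c1 _ d2.
have /= H3 := (cvgrPdist_lt _ _).1 c3 _ d2.
suff : \forall t \near nbhs (s, 0 : V),
    `|f (dil t.1 (t.2 + x)) - f (dil t.1 x)| <= d by [].
apply: filterS2 (H1 _) (H3 _) => t; rewrite add0r => h1 h3.
rewrite -(subrKA (f (dil s x))) (splitr d) (le_trans (ler_normD _ _)) //.
by apply: lerD; [rewrite distrC|]; exact: ltW.
Qed.

Local Lemma dil_mean_continuous (p : nat) (f : V -> R) :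
  Ck_on U 0 f -> Ck_on U 0 (dil_mean p f).
Proof.
move=> cf x Ux.
apply: (@cvgrPdist_le _ _ V (nbhs x) _ (dil_mean p f) (dil_mean p f x)).2 => d d0.
have yU : \forall y \near x, U y by apply: near_open oU Ux _.
have H : \forall y \near x, forall s, 0 <= s <= 1 ->
    `|f (dil s y) - f (dil s x)| <= d.
  have := dil_uniform Ux cf d0.
  by rewrite (near_shift x) sub0r; apply: filterS => y /=; rewrite subrK.
apply: filterS2 yU H => y Uy H.
have cx := dil_unit_continuous Ux cf (p := p).
have cy := dil_unit_continuous Uy cf (p := p).
rewrite distrC /dil_mean -unit_integralB //.
apply: unit_integral_le => [s s01|s s01]; first exact: (cvgB (cy s s01) (cx s s01)).
rewrite -mulrBr normrM (le_trans _ (H s s01)) // ler_piMl //.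
have /andP[s0 s1] := s01.
by rewrite normrX exprn_ile1 // ger0_norm.
Qed.

(** Differentiation under the integral sign: the mean value theorem turns the remainder into an
    oscillation of partial derivatives, which [dil_uniform] bounds uniformly in [s]. *)
Local Lemma dil_mean_diff (p : nat) (f : V -> R) x : U x -> Ck_on U 1 f ->
  differentiable (dil_mean p f) x /\ forall v, 'D_v (dil_mean p f) x =
  dil_mean p ('D_(lproj v) f) x + dil_mean p.+1 ('D_(rproj v) f) x.
Proof.
move=> Ux Cf; have [df cf] := Cf.
have Dc v : Ck_on U 0 ('D_v f) by exact: cf.
(* This is 'D_(dil s v) f (dil s x) only for s in [0, 1]; outside, dil s x may
   leave U, whereas the right-hand side stays continuous at 0 and 1. *)
pose D v s := 'D_(lproj v) f (dil s x) + s * 'D_(rproj v) f (dil s x).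
have DE v s : 0 <= s <= 1 -> D v s = 'D_(dil s v) f (dil s x).
  move=> s01; have dfs := df _ (ball_dil s01 Ux).
  by rewrite /D !deriveE // /dil linearD linearZ.
have DpE v s : s ^+ p * D v s = s ^+ p * 'D_(lproj v) f (dil s x) +
    s ^+ p.+1 * 'D_(rproj v) f (dil s x) by rewrite mulrDr mulrA -exprSr.
have IE v : unit_integral (fun s => s ^+ p * D v s) =
    dil_mean p ('D_(lproj v) f) x + dil_mean p.+1 ('D_(rproj v) f) x.
  rewrite -unit_integralD; [|exact: dil_unit_continuous Ux (Dc _)..].
  by apply: eq_unit_integral => s s01.
have cD v : unit_continuous (fun s => s ^+ p * D v s).
  have -> : (fun s => s ^+ p * D v s) = (fun s =>
      s ^+ p * 'D_(lproj v) f (dil s x) + s ^+ p.+1 * 'D_(rproj v) f (dil s x)).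
    by apply/funext => s.
  move=> s s01.
  exact: (cvgD (dil_unit_continuous Ux (Dc _) s01) (dil_unit_continuous Ux (Dc _) s01)).
pose L v := unit_integral (fun s => s ^+ p * D v s).
have linL : linear L.
  move=> a u v; have -> : a *: L u + L v = a * L u + L v by [].
  rewrite /L -unit_integralZ // -unit_integralD //; last first.
    by move=> s s01; exact: (cvgM (cvg_cst _) (cD u s s01)).
  apply: eq_unit_integral => s s01; rewrite !DE // !deriveE; try exact/df/ball_dil.
  by rewrite dilD dilZ linearD linearZ mulrDr mulrCA.
pose Ll := GRing.isLinear.Build _ _ _ _ L linL.
pose LL : {linear V -> R} := HB.pack L Ll.
suff [dJ JL] : differentiable (dil_mean p f) x /\ 'd (dil_mean p f) x = LL :> (_ -> _).
  by split=> // v; rewrite deriveE // JL -IE.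
apply: differentiable_dist => [|d d0]; first exact: linear_rV_continuous.
(* One share of [d] for each of the [m + k] partial derivatives; the successor avoids a zero
   denominator. *)
pose c := d / (m + k).+1%:R.
have c0 : 0 < c by rewrite divr_gt0 // ltr0n.
pose Q (j : 'I_(m + k)) (h : V) : Prop := forall s, 0 <= s <= 1 ->
  `|'D_(delta_mx ord0 j) f (dil s (h + x)) - 'D_(delta_mx ord0 j) f (dil s x)| <= c.
have H : \forall h \near nbhs (0 : V), forall j, Q j h.
  apply: filter_forall => j; exact: dil_uniform Ux (Dc _) c0.
have /nbhs_normP[del /= del0 Hdel] := H.
have yU : \forall h \near (0 : V), U (h + x).
  have : \forall z \near x, U z by apply: near_open oU Ux _.
  by rewrite (near_shift 0) subr0.
have hdel : \forall h \near (0 : V), `|h| < del by apply: nbhs0_lt.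
have C0 : Ck_on U 0 f by exact: Ck_on_pred.
near=> h.
have Uh : U (h + x) by near: h.
have hd : `|h| < del by near: h.
have cx := dil_unit_continuous Ux C0 (p := p).
have cy := dil_unit_continuous Uh C0 (p := p).
have cxy : unit_continuous
    (fun s => s ^+ p * f (dil s (h + x)) - s ^+ p * f (dil s x)).
  by move=> s s01; exact: (cvgB (cy s s01) (cx s s01)).
rewrite /dil_mean [X in _ - X](_ : _ = unit_integral (fun s => s ^+ p * D h s)) //.
rewrite -unit_integralB // -unit_integralB //.
apply: unit_integral_le => [s s01|s s01].
  exact: (cvgB (cxy s s01) (cD h s s01)).
rewrite -!mulrBr normrM -[leRHS]mul1r.
apply: ler_pM => //.
  by have /andP[s0 s1] := s01; rewrite normrX exprn_ile1 // ger0_norm.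
(* For fixed [s], the increment of [f] is its derivative along [dil s h] at a point that is again
   [dil s] of a point of the segment from [x] to [x + h]. *)
have [|t t01] := @segment_MVT _ _ f (dil s x) (dil s h).
  move=> t t01; apply: df; rewrite -dilZ -dilD; apply: ball_dil => //.
  by have := ball0_convex t01 Ux Uh; rewrite addrK.
rewrite -dilD [x + h]addrC => ->; rewrite DE //.
have Ut : U (x + t *: h) by have := ball0_convex t01 Ux Uh; rewrite addrK.
have Ust : U (dil s x + t *: dil s h) by rewrite -dilZ -dilD; exact: ball_dil.
rewrite [X in X - _]derive_sum_delta; last exact: df.
rewrite [X in _ - X]derive_sum_delta; last exact/df/ball_dil.
rewrite -sumrB (le_trans (ler_norm_sum _ _ _)) //.
rewrite (@le_trans _ _ (\sum_(j < m + k) `|h| * c)) //; last first.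
  rewrite sumr_const card_ord -mulr_natl mulrCA mulrC ler_wpM2r // /c.
  by rewrite mulrCA ger_pMr // ler_pdivrMr ?ltr0n // mul1r ler_nat.
apply: ler_sum => j _; rewrite -scalerBr normrM ler_pM //.
  by rewrite (le_trans (coord_le_norm _ _ _)) // norm_dil.
rewrite -dilZ -dilD [x + _]addrC; apply: (Hdel (t *: h) _ j s s01).
rewrite /= sub0r normrN normrZ (le_lt_trans _ hd) // ler_piMl //.
by have /andP[t0 t1] := t01; rewrite ger0_norm.
Unshelve. all: by end_near. Qed.

(** The derivatives of a mean are means of derivatives with weights [p] and [p.+1], so the induction
    on [n] runs over all [p] and [f] at once. *)
Lemma Ck_on_dil_mean (n p : nat) (f : V -> R) :
  Ck_on U n f -> Ck_on U n (dil_mean p f).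
Proof.
elim: n p f => [|n IH] p f; first exact: dil_mean_continuous.
move=> Cf; have [df cf] := Cf.
have C1 : Ck_on U 1 f by elim: n Cf {IH cf} => // n IH /Ck_on_pred.
split=> [x Ux|v]; first by have [] := dil_mean_diff p Ux C1.
apply: (@Ck_on_ext _ _ _ _ _ (fun x =>
  dil_mean p ('D_(lproj v) f) x + dil_mean p.+1 ('D_(rproj v) f) x)) => //.
  by move=> x Ux; have [_ ->] := dil_mean_diff p Ux C1.
by apply: Ck_onD => //; apply: IH; exact: cf.
Qed.

(** The derivative of [f (dil s x)] in [s] is integrated from 0 to 1; the direction [rproj x] has
    zero first block, so only the last [k] partial derivatives occur. *)
Lemma dil_mean_FTC (f : V -> R) x : U x -> Ck_on U 1 f ->
  f x = f (lproj x) + \sum_(j < k)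
    rsubmx x ord0 j * dil_mean 0 ('D_(delta_mx ord0 (rshift m j)) f) x.
Proof.
move=> Ux [df cf].
have cD v : unit_continuous (fun s => 'D_v f (dil s x)).
  have := dil_unit_continuous Ux (cf v) (p := 0%N).
  suff -> : (fun s => s ^+ 0 * 'D_v f (dil s x)) = (fun s => 'D_v f (dil s x)) by [].
  by apply/funext => t; rewrite expr0 mul1r.
rewrite -[LHS](subrKC (f (lproj x))); congr (_ + _).
have dF (s : R) : 0 <= s <= 1 ->
    is_derive s (1 : R) (fun t => f (dil t x)) ('D_(rproj x) f (dil s x)).
  by move=> s01; apply: is_derive_segment; exact/df/ball_dil.
have := unit_integral_FTC (cD _) dF; rewrite dil1 dil0l => <-.
pose e (j : 'I_k) : V := delta_mx ord0 (rshift m j).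
have czD j : unit_continuous
    (fun s => rsubmx x ord0 j * 'D_(e j) f (dil s x)).
  by move=> s s01; exact: (cvgM (cvg_cst _) (cD (e j) s s01)).
transitivity (unit_integral (fun s =>
    \sum_(j < k) rsubmx x ord0 j * 'D_(e j) f (dil s x))).
  apply: eq_unit_integral => s s01.
  rewrite derive_sum_delta; last exact/df/ball_dil.
  rewrite big_split_ord /= big1 ?add0r => [|j _].
    by apply: eq_bigr => j _; rewrite row_mxEr.
  by rewrite row_mxEl mxE scale0r.
rewrite unit_integral_sum //; apply: eq_bigr => j _.
rewrite unit_integralZ //; congr (_ * _).
by apply: eq_unit_integral => s _; rewrite expr0 mul1r.
Qed.

Lemma dil_mean0 (f : V -> R) : dil_mean 0 f 0 = f 0.
Proof.
rewrite -[RHS]unit_integral_cst.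
by apply: eq_unit_integral => s _; rewrite dil0 expr0 mul1r.
Qed.

End Hadamard.

(** The entries of [N] are means of partial derivatives. As dilations fix 0, [N 0] consists of the
    partial derivatives themselves; the last clause records this and later yields the invertibility
    of a block of [N]. *)
Theorem hadamard (R : realType) (m k q : nat)
    (f : 'rV[R]_(m + k) -> 'cV[R]_q) : smooth_germ f ->
  exists N : 'rV[R]_(m + k) -> 'M[R]_(q, k), [/\ smooth_germ N,
    \forall x \near (0 : 'rV[R]_(m + k)),
      f x = f (row_mx (lsubmx x) 0) + N x *m (rsubmx x)^T &
    forall v : 'rV[R]_k, 'D_(row_mx 0 v) f 0 = N 0 *m v^T].
Proof.
move=> Sf; have /smooth_germP Cf0 := Sf.
near (0 : R)^'+ => r.
have r0 : 0 < r by near: r; exact: nbhs_right_gt.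
have Cf : forall n, Ck_on (ball 0 r) n f by near: r.
have oU : open (ball (0 : 'rV[R]_(m + k)) r) by exact: ball_open.
have Cfi i n : Ck_on (ball 0 r) n (fun x => f x i ord0 : R).
  exact: (Ck_on_mxP _ _ oU).1 (Cf n) i ord0.
pose fj i (j : 'I_k) := 'D_(delta_mx ord0 (rshift m j)) (fun x => f x i ord0 : R).
pose N x : 'M[R]_(q, k) := \matrix_(i, j) dil_mean 0 (fj i j) x.
exists N; split.
- exists (ball 0 r); split=> // [|n]; first exact: ballxx.
  apply/Ck_on_mxP => // i j.
  apply: (@Ck_on_ext _ _ _ _ _ (dil_mean 0 (fj i j))) => //.
    by move=> x _; rewrite mxE.
  by apply: Ck_on_dil_mean => //; exact: (Cfi i n.+1).2.
- have U0 : ball (0 : 'rV[R]_(m + k)) r 0 by exact: ballxx.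
  apply: near_open oU U0 _ => x Ux.
  apply/matrixP => i j; rewrite (ord1 j) (dil_mean_FTC Ux (Cfi i 1%N)) !mxE.
  by congr (_ + _); apply: eq_bigr => l _; rewrite !mxE mulrC.
- move=> v; have df := smooth_germ_differentiable0 Sf.
  apply/matrixP => i j; rewrite (ord1 j) -derive_coord // mxE.
  rewrite derive_sum_delta; last by move/differentiable_mxP : df; exact.
  rewrite big_split_ord /= big1 ?add0r => [|l _].
    by apply: eq_bigr => l _; rewrite row_mxEr !mxE dil_mean0 mulrC.
  by rewrite row_mxEl mxE scale0r.
Unshelve. all: by end_near. Qed.

(** * Equivalence of constraint germs *)

Section PosDiagPerm.
Variable R : realType.

Lemma diag_perm_mxE (q : nat) (s : 'S_q) (d : 'rV[R]_q) i j :
  (diag_mx d *m perm_mx s) i j = d ord0 i * (s i == j)%:R.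
Proof. by rewrite mul_diag_mx !mxE. Qed.

(** Moving a permutation past a diagonal matrix restores the normal form in products and
    inverses. *)
Lemma perm_diag_mx (q : nat) (s : 'S_q) (d : 'rV[R]_q) :
  perm_mx s *m diag_mx d = diag_mx (\row_i d ord0 (s i)) *m perm_mx s.
Proof.
apply/matrixP => i j; rewrite mul_mx_diag mul_diag_mx !mxE.
by case: eqP => [->|_]; rewrite ?mul1r ?mulr1 ?mul0r ?mulr0.
Qed.

Lemma pos_diag_perm_mxM (q : nat) (M N : 'M[R]_q) :
  pos_diag_perm_mx M -> pos_diag_perm_mx N -> pos_diag_perm_mx (M *m N).
Proof.
move=> [d [s [d0 ->]]] [d' [s' [d0' ->]]].
exists (\row_i (d ord0 i * d' ord0 (s i))), (s * s')%g.
split; first by move=> i; rewrite mxE mulr_gt0.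
rewrite -mulmxA (mulmxA (perm_mx s)) perm_diag_mx -(mulmxA (diag_mx _)).
rewrite -perm_mxM mulmxA; congr (_ *m _).
apply/matrixP => i j; rewrite mul_diag_mx !mxE.
by case: eqP => [->|_]; rewrite ?mulr1n ?mulr0n ?mulr0.
Qed.

Lemma pos_diag_mx (q : nat) (d : 'rV[R]_q) :
  (forall i, 0 < d ord0 i) -> pos_diag_perm_mx (diag_mx d).
Proof. by move=> d0; exists d, 1%g; split=> //; rewrite perm_mx1 mulmx1. Qed.

Lemma perm_pos_diag_perm_mx (q : nat) (s : 'S_q) :
  pos_diag_perm_mx (perm_mx s : 'M[R]_q).
Proof.
exists (const_mx 1), s; split; first by move=> i; rewrite mxE.
by rewrite diag_const_mx mul1mx.
Qed.

Lemma pos_diag_perm_mxV (q : nat) (M : 'M[R]_q) :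
  pos_diag_perm_mx M -> M \in unitmx /\ pos_diag_perm_mx (invmx M).
Proof.
move=> [d [s [d0 ->]]].
pose e : 'rV[R]_q := \row_i (d ord0 i)^-1.
have de : diag_mx d *m diag_mx e = 1%:M.
  apply/matrixP => i j; rewrite mul_diag_mx !mxE.
  by case: eqP => [->|_]; rewrite ?mulr0 // mulr1n mulfV // gt_eqF.
have U : diag_mx d *m perm_mx s *m (perm_mx s^-1 *m diag_mx e) = 1%:M.
  rewrite mulmxA -(mulmxA (diag_mx d)) -perm_mxM mulgV perm_mx1 mulmx1.
  exact: de.
have [Mu _] := mulmx1_unit U; split=> //.
rewrite -(mulmx1 (invmx _)) -U mulKmx // perm_diag_mx.
by eexists _, _; split; last reflexivity; move=> i; rewrite !mxE invr_gt0.
Qed.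

(** The permutation is extended by the identity on the last [p] indices, the diagonal by ones. *)
Lemma pos_diag_perm_block1 (q p : nat) (M : 'M[R]_q) :
  pos_diag_perm_mx M -> pos_diag_perm_mx (block_mx M 0 0 (1%:M : 'M[R]_p)).
Proof.
move=> [d [s [d0 ->]]].
pose f (i : 'I_(q + p)) := match fintype.split i with
  | inl a => lshift p (s a) | inr b => rshift q b end.
have fl a : f (lshift p a) = lshift p (s a) by rewrite /f (unsplitK (inl a)).
have fr b : f (rshift q b) = rshift q b by rewrite /f (unsplitK (inr b)).
have f_inj : injective f.
  move=> i j; case: (split_ordP i) => a ->; case: (split_ordP j) => b ->;
    rewrite ?fl ?fr.
  - by move/lshift_inj/perm_inj ->.
  - by move/eqP; rewrite eq_lrshift.
  - by move/eqP; rewrite eq_rlshift.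
  - by [].
exists (row_mx d (const_mx 1)), (perm f_inj); split.
  by move=> i; case: (split_ordP i) => a ->; rewrite ?row_mxEl ?row_mxEr ?mxE.
apply/matrixP => i j; rewrite [RHS]diag_perm_mxE permE.
case: (split_ordP i) => a ->; case: (split_ordP j) => b ->;
  rewrite ?block_mxEul ?block_mxEur ?block_mxEdl ?block_mxEdr
    ?row_mxEl ?row_mxEr ?fl ?fr.
- by rewrite diag_perm_mxE (inj_eq (@lshift_inj _ _)).
- by rewrite eq_lrshift mulr0 mxE.
- by rewrite eq_rlshift mulr0 mxE.
- by rewrite !mxE (inj_eq (@rshift_inj _ _)) mul1r.
Qed.

End PosDiagPerm.

(** * Smoothness of block matrices and projections *)

Section SmoothBlocks.
Variables (R : realType) (n : nat).

Lemma smooth_germ_entries (a b : nat) (f : 'rV[R]_n -> 'M[R]_(a, b)) :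
  smooth_germ f -> forall i j, smooth_germ (fun x => f x i j : R).
Proof. by move/smooth_germ_mxP. Qed.

Lemma smooth_germ_eq (W : normedModType R) (f g : 'rV[R]_n -> W) :
  f =1 g -> smooth_germ f -> smooth_germ g.
Proof. by move=> /funext ->. Qed.

Lemma smooth_germ_row_mx (a b c : nat) (f : 'rV[R]_n -> 'M[R]_(a, b))
    (g : 'rV[R]_n -> 'M[R]_(a, c)) :
  smooth_germ f -> smooth_germ g -> smooth_germ (fun x => row_mx (f x) (g x)).
Proof.
move=> /smooth_germ_entries Sf /smooth_germ_entries Sg.
apply/smooth_germ_mxP => i j; case: (split_ordP j) => t ->.
  by apply: smooth_germ_eq (Sf i t) => x; rewrite row_mxEl.
by apply: smooth_germ_eq (Sg i t) => x; rewrite row_mxEr.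
Qed.

Lemma smooth_germ_col_mx (a b c : nat) (f : 'rV[R]_n -> 'M[R]_(a, c))
    (g : 'rV[R]_n -> 'M[R]_(b, c)) :
  smooth_germ f -> smooth_germ g -> smooth_germ (fun x => col_mx (f x) (g x)).
Proof.
move=> /smooth_germ_entries Sf /smooth_germ_entries Sg.
apply/smooth_germ_mxP => i j; case: (split_ordP i) => t ->.
  by apply: smooth_germ_eq (Sf t j) => x; rewrite col_mxEu.
by apply: smooth_germ_eq (Sg t j) => x; rewrite col_mxEd.
Qed.

Lemma smooth_germ_block_mx (a b c d : nat) (f : 'rV[R]_n -> 'M[R]_(a, c))
    (g : 'rV[R]_n -> 'M[R]_(a, d)) (h : 'rV[R]_n -> 'M[R]_(b, c))
    (e : 'rV[R]_n -> 'M[R]_(b, d)) :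
  smooth_germ f -> smooth_germ g -> smooth_germ h -> smooth_germ e ->
  smooth_germ (fun x => block_mx (f x) (g x) (h x) (e x)).
Proof.
by move=> Sf Sg Sh Se; apply: smooth_germ_col_mx; exact: smooth_germ_row_mx.
Qed.

Lemma smooth_germ_usubmx (a b c : nat) (f : 'rV[R]_n -> 'M[R]_(a + b, c)) :
  smooth_germ f -> smooth_germ (fun x => usubmx (f x)).
Proof.
move=> /smooth_germ_entries Sf; apply/smooth_germ_mxP => i j.
by apply: smooth_germ_eq (Sf (lshift b i) j) => x; rewrite mxE.
Qed.

Lemma smooth_germ_dsubmx (a b c : nat) (f : 'rV[R]_n -> 'M[R]_(a + b, c)) :
  smooth_germ f -> smooth_germ (fun x => dsubmx (f x)).
Proof.
move=> /smooth_germ_entries Sf; apply/smooth_germ_mxP => i j.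
by apply: smooth_germ_eq (Sf (rshift a i) j) => x; rewrite mxE.
Qed.

Lemma smooth_germ_trmx (a b : nat) (f : 'rV[R]_n -> 'M[R]_(a, b)) :
  smooth_germ f -> smooth_germ (fun x => (f x)^T).
Proof.
move=> /smooth_germ_entries Sf; apply/smooth_germ_mxP => i j.
by apply: smooth_germ_eq (Sf j i) => x; rewrite mxE.
Qed.

Lemma smooth_germ_diag_mx (a : nat) (f : 'rV[R]_n -> 'rV[R]_a) :
  smooth_germ f -> smooth_germ (fun x => diag_mx (f x)).
Proof.
move=> /smooth_germ_entries Sf; apply/smooth_germ_mxP => i j.
have [->|ij] := eqVneq i j.
  by apply: smooth_germ_eq (Sf ord0 j) => x; rewrite mxE eqxx mulr1n.
apply: smooth_germ_eq (smooth_germ_cst _ (0 : R)) => x.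
by rewrite mxE (negbTE ij) mulr0n.
Qed.

End SmoothBlocks.

Section SmoothProjections.
Variables (R : realType) (m k : nat).

Lemma smooth_germ_lsubmx : smooth_germ (fun x : 'rV[R]_(m + k) => lsubmx x).
Proof.
apply/smooth_germ_mxP => i j; rewrite (ord1 i).
by apply: smooth_germ_eq (smooth_germ_coord _ (lshift k j)) => x; rewrite mxE.
Qed.

Lemma smooth_germ_rsubmx : smooth_germ (fun x : 'rV[R]_(m + k) => rsubmx x).
Proof.
apply/smooth_germ_mxP => i j; rewrite (ord1 i).
by apply: smooth_germ_eq (smooth_germ_coord _ (rshift m j)) => x; rewrite mxE.
Qed.

Lemma near0_lsubmx (P : 'rV[R]_m -> Prop) :
  (\forall y \near (0 : 'rV[R]_m), P y) ->
  \forall x \near (0 : 'rV[R]_(m + k)), P (lsubmx x).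
Proof.
apply: near0_comp; last by rewrite linear0.
exact: smooth_germ_continuous smooth_germ_lsubmx.
Qed.

End SmoothProjections.

(** * Symmetry and transitivity of the equivalence; permutations of constraints *)

Section Equivalence.
Variable R : realType.

Lemma near0W (n : nat) (P : 'rV[R]_n -> Prop) :
  (forall x, P x) -> \forall x \near (0 : 'rV[R]_n), P x.
Proof. by move=> PT; near=> x. Unshelve. all: by end_near. Qed.

Lemma diffeo_germ_id (n : nat) : diffeo_germ (fun x : 'rV[R]_n => x) (fun x => x).
Proof.
have S := smooth_germ_id R n.
by split; [split|split|apply: near0W|apply: near0W].
Qed.

Lemma diffeo_germ_near (m n : nat) (Phi : 'rV[R]_m -> 'rV[R]_n) Psi
    (P : 'rV[R]_m -> Prop) : diffeo_germ Phi Psi ->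
  (\forall y \near (0 : 'rV[R]_m), P y) ->
  \forall x \near (0 : 'rV[R]_n), P (Psi x).
Proof.
move=> [_ [SPsi Psi0] _ _]; apply: near0_comp => //.
exact: smooth_germ_continuous.
Qed.

Lemma diffeo_germ_sym (m n : nat) (Phi : 'rV[R]_m -> 'rV[R]_n) Psi :
  diffeo_germ Phi Psi -> diffeo_germ Psi Phi.
Proof. by move=> [a b c d]; split. Qed.

Lemma diffeo_germ_comp (m n p : nat) (Phi : 'rV[R]_n -> 'rV[R]_m) Psi
    (Phi' : 'rV[R]_p -> 'rV[R]_n) Psi' :
  diffeo_germ Phi Psi -> diffeo_germ Phi' Psi' ->
  diffeo_germ (Phi \o Phi') (Psi' \o Psi).
Proof.
move=> D D'; have [[SPhi Phi0] [SPsi Psi0] i1 i2] := D.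
have [[SPhi' Phi0'] [SPsi' Psi0'] i1' i2'] := D'.
split.
- by split; [exact: smooth_germ_comp | rewrite /= Phi0'].
- by split; [exact: smooth_germ_comp | rewrite /= Psi0].
- have := diffeo_germ_near (diffeo_germ_sym D') i1.
  by apply: filterS2 i1' => x /= E ->.
- have := diffeo_germ_near D i2'.
  by apply: filterS2 i2 => x /= E ->.
Qed.

(** The triple [C], [B], [A] acts as the block triangular matrix with rows [(C, B)] and [(0, A)];
    the witnesses are the blocks of the product, the second factor being pulled back by [Psi]. *)
Lemma KG_equiv_trans (n n' n'' q r : nat) (F : constraint_map R n q r)
    (F' : constraint_map R n' q r) (F'' : constraint_map R n'' q r) :
  KG_equiv F F' -> KG_equiv F' F'' -> KG_equiv F F''.
Proof.
move=> [nn' [Phi [Psi [C [B [A [D [SC SB SA] HC HA HF]]]]]]].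
move=> [nn'' [Phi' [Psi' [C' [B' [A' [D' [SC' SB' SA'] HC' HA' HF']]]]]]].
split; first by rewrite nn'.
have [_ [SPsi Psi0] _ _] := D.
have Sc a b (f : 'rV[R]_n' -> 'M[R]_(a, b)) : smooth_germ f ->
    smooth_germ (fun x => f (Psi x)) by move=> Sf; exact: smooth_germ_comp.
exists (Phi \o Phi'), (Psi' \o Psi), (fun x => C x *m C' (Psi x)),
  (fun x => C x *m B' (Psi x) + B x *m A' (Psi x)), (fun x => A x *m A' (Psi x)).
split; first exact: diffeo_germ_comp.
- by split; [|apply: smooth_germD|]; apply: smooth_germ_mulmx => //; exact: Sc.
- have := diffeo_germ_near D HC'.
  by apply: filterS2 HC => x; exact: pos_diag_perm_mxM.
- have := diffeo_germ_near D HA'.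
  by apply: filterS2 HA => x; rewrite unitmx_mul => -> ->.
- have := diffeo_germ_near D HF'.
  apply: filterS2 HF => x [-> ->] [-> ->] /=; split; last by rewrite mulmxA.
  by rewrite mulmxDr mulmxDl !mulmxA addrA.
Qed.

(** The witnesses are the blocks of the inverse of that triangular matrix, pulled back by [Phi]. *)
Lemma KG_equiv_sym (n n' q r : nat) (F : constraint_map R n q r)
    (F' : constraint_map R n' q r) : KG_equiv F F' -> KG_equiv F' F.
Proof.
move=> [nn' [Phi [Psi [C [B [A [D [SC SB SA] HC HA HF]]]]]]].
split=> //; have D' := diffeo_germ_sym D.
have [[SPhi Phi0] _ i1 _] := D.
have Sc a b (f : 'rV[R]_n -> 'M[R]_(a, b)) : smooth_germ f ->
    smooth_germ (fun x => f (Phi x)) by move=> Sf; exact: smooth_germ_comp.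
have HCi : \forall x \near (0 : 'rV[R]_n), C x \in unitmx.
  by apply: filterS HC => x /pos_diag_perm_mxV[].
have SCi := smooth_germ_invmx HCi SC; have SAi := smooth_germ_invmx HA SA.
exists Psi, Phi, (fun x => invmx (C (Phi x))),
  (fun x => - (invmx (C (Phi x)) *m B (Phi x) *m invmx (A (Phi x)))),
  (fun x => invmx (A (Phi x))).
split=> //.
- split; [exact: Sc SCi| |exact: Sc SAi].
  apply: smooth_germN; apply: smooth_germ_mulmx; last exact: Sc SAi.
  by apply: smooth_germ_mulmx; [exact: Sc SCi | exact: Sc].
- have := diffeo_germ_near D' HC.
  by apply: filterS => x /pos_diag_perm_mxV[].
- have := diffeo_germ_near D' HA.
  by apply: filterS => x; rewrite unitmx_inv.
- have H1 := diffeo_germ_near D' HF; have H2 := diffeo_germ_near D' HCi.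
  have H3 := diffeo_germ_near D' HA.
  near=> x.
  have xE : Psi (Phi x) = x by near: x.
  have Cu : C (Phi x) \in unitmx by near: x.
  have Au : A (Phi x) \in unitmx by near: x.
  have : ineq F (Phi x) = C (Phi x) *m ineq F' (Psi (Phi x)) +
      B (Phi x) *m equa F' (Psi (Phi x)) /\
      equa F (Phi x) = A (Phi x) *m equa F' (Psi (Phi x)) by near: x.
  rewrite xE => -[-> ->]; rewrite mulmxDr mulKmx // mulKmx //; split=> //.
  by rewrite mulNmx -(mulmxA (_ *m B (Phi x))) mulKmx // mulmxA addrK.
Unshelve. all: by end_near. Qed.

Definition permuted_constraints (n q r : nat) (F : constraint_map R n q r)
    (s : 'S_q) (t : 'S_r) : constraint_map R n q r :=
  ConstraintMap (fun x => row_perm s (ineq F x)) (fun x => row_perm t (equa F x)).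

Lemma KG_equiv_permuted (n q r : nat) (F : constraint_map R n q r)
    (s : 'S_q) (t : 'S_r) : KG_equiv (permuted_constraints F s t) F.
Proof.
split=> //; exists id, id, (fun=> perm_mx s), (fun=> 0), (fun=> perm_mx t).
split.
- exact: diffeo_germ_id.
- by split; exact: smooth_germ_cst.
- by apply: near0W => _; exact: perm_pos_diag_perm_mx.
- by apply: near0W => _; exact: unitmx_perm.
- by apply: near0W => x /=; rewrite mul0mx addr0 !row_permE.
Qed.

End Equivalence.

(** * Suspension of a constraint map *)

Section Suspension.
Variable R : realType.

Definition suspension (m s l k p : nat) (E : constraint_map R m s l) :
    constraint_map R (m + k) (s + p) (l + k) :=
  ConstraintMap (fun x => col_mx (ineq E (lsubmx x)) (const_mx (-1)))
                (fun x => col_mx (equa E (lsubmx x)) (rsubmx x)^T).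

Lemma diffeo_germ_row_mx (m n k : nat) (Phi : 'rV[R]_m -> 'rV[R]_n) Psi :
  diffeo_germ Phi Psi ->
  diffeo_germ (fun x : 'rV[R]_(m + k) => row_mx (Phi (lsubmx x)) (rsubmx x))
              (fun x : 'rV[R]_(n + k) => row_mx (Psi (lsubmx x)) (rsubmx x)).
Proof.
have S a b (f : 'rV[R]_a -> 'rV[R]_b) : smooth_germ f /\ f 0 = 0 ->
    smooth_germ (fun x : 'rV[R]_(a + k) => row_mx (f (lsubmx x)) (rsubmx x)) /\
    row_mx (f (lsubmx (0 : 'rV[R]_(a + k)))) (rsubmx (0 : 'rV[R]_(a + k))) = 0.
  move=> [Sf f0]; split; last by rewrite !linear0 f0 row_mx0.
  apply: smooth_germ_row_mx (smooth_germ_rsubmx _ _ _).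
  by apply: smooth_germ_comp Sf (smooth_germ_lsubmx _ _ _) _; rewrite linear0.
have I a b (f : 'rV[R]_a -> 'rV[R]_b) g :
    (\forall x \near (0 : 'rV[R]_a), g (f x) = x) ->
    \forall x \near (0 : 'rV[R]_(a + k)),
      row_mx (g (lsubmx (row_mx (f (lsubmx x)) (rsubmx x))))
        (rsubmx (row_mx (f (lsubmx x)) (rsubmx x))) = x.
  move=> /near0_lsubmx H; apply: filterS (H k) => x gf.
  by rewrite row_mxKl row_mxKr gf hsubmxK.
by move=> [S1 S2 i1 i2]; split; [exact: S|exact: S|exact: I|exact: I].
Qed.

(** The adjoined coordinates and constraints are the same on both sides, so every datum is extended
    by the identity, and [B] by zero. *)
Lemma KG_equiv_suspension (m m' s l k p : nat) (E : constraint_map R m s l)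
    (E' : constraint_map R m' s l) : KG_equiv E E' ->
  KG_equiv (suspension k p E) (suspension k p E').
Proof.
move=> [mm' [Phi [Psi [C [B [A [D [SC SB SA] HC HA HE]]]]]]].
split; first by rewrite mm'.
have Sl a b (f : 'rV[R]_m -> 'M[R]_(a, b)) : smooth_germ f ->
    smooth_germ (fun x : 'rV[R]_(m + k) => f (lsubmx x)).
  by move=> Sf; apply: smooth_germ_comp Sf (smooth_germ_lsubmx _ _ _) _; rewrite linear0.
exists (fun x => row_mx (Phi (lsubmx x)) (rsubmx x)),
  (fun x => row_mx (Psi (lsubmx x)) (rsubmx x)),
  (fun x => block_mx (C (lsubmx x)) 0 0 1%:M),
  (fun x => block_mx (B (lsubmx x)) 0 0 0),
  (fun x => block_mx (A (lsubmx x)) 0 0 1%:M).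
split.
- exact: diffeo_germ_row_mx.
- by split; apply: smooth_germ_block_mx;
    by [exact: smooth_germ_cst | exact: Sl SC | exact: Sl SB | exact: Sl SA].
- apply: filterS (near0_lsubmx k HC) => x; exact: pos_diag_perm_block1.
- apply: filterS (near0_lsubmx k HA) => x.
  by rewrite !unitmxE det_ublock det1 mulr1.
- apply: filterS (near0_lsubmx k HE) => x [Ei Ee] /=.
  rewrite row_mxKl row_mxKr !mul_block_col !mul0mx !mul1mx !addr0 !add0r.
  by rewrite add_col_mx addr0 Ei Ee.
Qed.

End Suspension.

(** * Reductions *)

Lemma derive_comp (R : realType) (m n : nat) (W : normedModType R)
    (f : 'rV[R]_n -> W) (g : 'rV[R]_m -> 'rV[R]_n) x v :
  differentiable g x -> differentiable f (g x) ->
  'D_v (fun y => f (g y)) x = 'D_('D_v g x) f (g x).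
Proof.
move=> dg df; rewrite deriveE; last exact: (differentiable_comp dg df).
transitivity ('d (f \o g) x v) => //.
by rewrite (diff_comp dg df) /= !deriveE.
Qed.

Lemma jac_eq (R : realType) (m n : nat) (f : 'rV[R]_m -> 'rV[R]_n) x M :
  (forall v, 'D_v f x = v *m M) -> jac f x = M.
Proof.
by move=> fM; apply/matrixP => i j; rewrite mxE fM -rowE mxE.
Qed.

Lemma derive_linear (R : realType) (n : nat) (W : normedModType R)
    (f : {linear 'rV[R]_n -> W}) x v : continuous f -> 'D_v f x = f v.
Proof.
by move=> cf; rewrite deriveE ?diff_lin //; exact: linear_differentiable.
Qed.

Lemma derive_trmx_dsubmx (R : realType) (n a b : nat)
    (f : 'rV[R]_n -> 'cV[R]_(a + b)) x v : differentiable f x ->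
  'D_v (fun y => (dsubmx (f y))^T) x = (dsubmx ('D_v f x))^T.
Proof.
move=> df.
have E i j : (fun y => (dsubmx (f y))^T i j : R) = (fun y => f y (rshift a j) i).
  by apply/funext => y; rewrite !mxE.
have dfT : differentiable (fun y => (dsubmx (f y))^T) x.
  by apply/differentiable_mxP => i j; rewrite E; move/differentiable_mxP : df; exact.
by apply/matrixP => i j; rewrite -(derive_coord _ _ _ dfT) E derive_coord // !mxE.
Qed.

(** * A chart adapted to the removed equality constraints *)

Section Straightening.
Variables (R : realType) (m k : nat).
Variables (h : 'rV[R]_(m + k) -> 'rV[R]_k) (iota : 'rV[R]_m -> 'rV[R]_(m + k)).
Hypotheses (Sh : smooth_germ h) (Si : smooth_germ iota) (i0 : iota 0 = 0).
Hypothesis hi : \forall y \near (0 : 'rV[R]_m), h (iota y) = 0.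
Hypothesis iota_imm : injective ('d iota (0 : 'rV[R]_m)).
Hypothesis h_sub : forall c : 'rV[R]_k,
  (forall v, 'D_v h 0 *m c^T = 0) -> c = 0.

(* W is a left inverse of the Jacobian of h, so that the rows of W span a
   complement of the tangent space of the zero set of h. *)
Lemma straightening : exists (W : 'M[R]_(k, m + k)) Psi,
  diffeo_germ (fun x => iota (lsubmx x) + rsubmx x *m W) Psi /\
  forall z : 'rV[R]_k,
    'D_(row_mx 0 z) (fun x => h (iota (lsubmx x) + rsubmx x *m W)) 0 = z.
Proof.
have dh := smooth_germ_differentiable0 Sh.
have di := smooth_germ_differentiable0 Si.
set H := jac h 0; set J := jac iota 0.
(* A column vector killed by [H] is a linear relation between the differentials of the components of
   [h]; without such relations [H] has rank [k], which provides [W]. *)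
have Hfull : row_full H.
  rewrite /row_full -mxrank_tr; apply: inj_row_free => c.
  move=> cH; apply: h_sub => v; rewrite derive_jac // -/H -mulmxA.
  by rewrite -[H]trmxK -trmx_mul cH trmx0 mulmx0.
have [W WH] := row_fullP Hfull.
(* This differentiates at 0 the identity [h (iota y) = 0], valid near 0. *)
have JH : J *m H = 0.
  apply/row_matrixP => i; rewrite !rowE mulmx0 mulmxA -derive_jac //.
  have dhi : differentiable h (iota 0) by rewrite i0.
  rewrite -derive_jac // -i0 -(derive_comp _ di dhi).
  rewrite (near_eq_derive _ hi); exact: derive_cst.
have Jfree : row_free J.
  apply: inj_row_free => v vJ; apply: iota_imm.
  by rewrite linear0 -deriveE // derive_jac.
pose Phi := fun x : 'rV[R]_(m + k) => iota (lsubmx x) + rsubmx x *m W.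
have Sl := smooth_germ_lsubmx R m k; have Sr := smooth_germ_rsubmx R m k.
have Sil : smooth_germ (fun x : 'rV[R]_(m + k) => iota (lsubmx x)).
  by apply: smooth_germ_comp Si Sl _; rewrite linear0.
have SrW : smooth_germ (fun x : 'rV[R]_(m + k) => rsubmx x *m W).
  by apply: smooth_germ_mulmx Sr _; exact: smooth_germ_cst.
have SPhi : smooth_germ Phi by exact: smooth_germD.
have Phi0 : Phi 0 = 0 by rewrite /Phi !linear0 i0 mul0mx addr0.
have DPhi v : 'D_v Phi 0 = lsubmx v *m J + rsubmx v *m W.
  have dl := differentiable_lsubmx (0 : 'rV[R]_(m + k)).
  have dr := differentiable_rsubmx (0 : 'rV[R]_(m + k)).
  have Dl : 'D_v (lsubmx : 'rV[R]_(m + k) -> 'rV[R]_m) 0 = lsubmx v.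
    apply: derive_linear => x.
    exact/differentiable_continuous/differentiable_lsubmx.
  have Dr : 'D_v (rsubmx : 'rV[R]_(m + k) -> 'rV[R]_k) 0 = rsubmx v.
    apply: derive_linear => x.
    exact/differentiable_continuous/differentiable_rsubmx.
  have [drW JrW] := jac_mulmxr W dr.
  have dil : differentiable iota (lsubmx (0 : 'rV[R]_(m + k))).
    by rewrite linear0.
  rewrite [LHS]deriveD; last first.
  - exact: diff_derivable.
  - by apply: diff_derivable; exact: (differentiable_comp dl dil).
  rewrite (derive_comp _ dl dil) Dl linear0 derive_jac //; congr (_ + _).
  by rewrite derive_jac // JrW mulmxA -derive_jac // Dr.
have JPhi : jac Phi 0 = col_mx J W.
  by apply: jac_eq => v; rewrite DPhi -[v in RHS]hsubmxK mul_row_col.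
(* Multiplying a relation between the rows of [J] and [W] by [H] kills [J] and isolates the
   coefficients of [W]; those of [J] then vanish because [iota] is an immersion. *)
have JU : jac Phi 0 \in unitmx.
  rewrite -row_free_unit JPhi; apply: inj_row_free => v.
  rewrite -[v]hsubmxK mul_row_col => E.
  have r0 : rsubmx v = 0.
    have := congr1 (mulmx^~ H) E.
    by rewrite mulmxDl -!mulmxA JH WH mulmx0 add0r mulmx1 mul0mx.
  move: E; rewrite r0 mul0mx addr0 => lJ.
  suff -> : lsubmx v = 0 by rewrite row_mx0.
  by apply: (row_free_inj Jfree); rewrite mul0mx.
have [Psi D] := inverse_function SPhi Phi0 JU.
exists W, Psi; split=> // z.
have dhP : differentiable h (Phi 0) by rewrite Phi0.
have dP := smooth_germ_differentiable0 SPhi.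
rewrite (derive_comp _ dP dhP) Phi0 DPhi row_mxKl row_mxKr mul0mx add0r.
by rewrite derive_jac // -mulmxA WH mulmx1.
Qed.

End Straightening.

Section Reduction.
Variable R : realType.

(** The case where the removed constraints are the last ones. In the straightening chart, the
    matrices of the equivalence are read off from Hadamard's lemma. *)
Lemma KG_equiv_block_reduction (m k s p l : nat)
    (F : constraint_map R (m + k) (s + p) (l + k)) (E : constraint_map R m s l)
    (iota : 'rV[R]_m -> 'rV[R]_(m + k)) :
  constraint_germ F -> smooth_germ iota -> iota 0 = 0 ->
  injective ('d iota (0 : 'rV[R]_m)) ->
  (forall b, ineq F 0 (rshift s b) ord0 < 0) ->
  (\forall y \near (0 : 'rV[R]_m), dsubmx (equa F (iota y)) = 0) ->
  (forall c : 'rV[R]_k,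
    (forall v, 'D_v (fun x => (dsubmx (equa F x))^T) 0 *m c^T = 0) -> c = 0) ->
  (\forall y \near (0 : 'rV[R]_m), ineq E y = usubmx (ineq F (iota y)) /\
     equa E y = usubmx (equa F (iota y))) ->
  KG_equiv F (suspension k p E).
Proof.
move=> [Sg Sh h0] Si i0 imm gneg hZ hsub EF.
have SdT : smooth_germ (fun x => (dsubmx (equa F x))^T).
  by apply: smooth_germ_trmx; exact: smooth_germ_dsubmx.
have dZ : \forall y \near (0 : 'rV[R]_m), (dsubmx (equa F (iota y)))^T = 0.
  by apply: filterS hZ => y ->; rewrite trmx0.
have [W [Psi [D hW]]] := straightening SdT Si i0 dZ imm hsub.
move: D hW; set Phi := (fun x => iota (lsubmx x) + rsubmx x *m W) => D hW.
have [[SPhi Phi0] [SPsi Psi0] i1 i2] := D.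
have SgP : smooth_germ (fun u => ineq F (Phi u)) by exact: smooth_germ_comp.
have ShP : smooth_germ (fun u => equa F (Phi u)) by exact: smooth_germ_comp.
have PhiE (y : 'rV[R]_m) : Phi (row_mx y 0) = iota y.
  by rewrite /Phi row_mxKl row_mxKr mul0mx addr0.
have [Ng [SNg gN _]] := hadamard SgP.
have [Nh [SNh hN Nh0]] := hadamard ShP.
(* At [z = 0] the kept constraints are those of [E] and the removed equalities vanish; the columns
   of [Nh] and [Ng] add the correction linear in [z]. *)
pose A0 u := block_mx 1%:M (usubmx (Nh u)) 0 (dsubmx (Nh u)).
pose B0 u : 'M[R]_(s + p, l + k) := block_mx 0 (usubmx (Ng u)) 0 0.
(* A removed inequality is written as its opposite, positive near 0, times the constant -1 of the
   suspension. *)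
pose d u : 'rV[R]_(s + p) := row_mx (const_mx 1) (- (dsubmx (ineq F (Phi u)))^T).
have SA0 : smooth_germ A0.
  apply: smooth_germ_block_mx; try exact: smooth_germ_cst.
    exact: smooth_germ_usubmx.
  exact: smooth_germ_dsubmx.
have SB0 : smooth_germ B0.
  apply: smooth_germ_block_mx; try exact: smooth_germ_cst.
  exact: smooth_germ_usubmx.
have Sd : smooth_germ d.
  apply: smooth_germ_row_mx; first exact: smooth_germ_cst.
  by apply: smooth_germN; apply: smooth_germ_trmx; exact: smooth_germ_dsubmx.
(* This block is the derivative at 0 of the removed equalities along [z], which the chart makes the
   identity. *)
have dNh : dsubmx (Nh 0) = 1%:M.
  apply: trmx_inj; apply/row_matrixP => i; rewrite !rowE trmx1 mulmx1.
  rewrite -[RHS]hW derive_trmx_dsubmx; last exact: smooth_germ_differentiable0.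
  by rewrite Nh0 -mul_dsub_mx trmx_mul trmxK.
have A0u : \forall u \near (0 : 'rV[R]_(m + k)), A0 u \in unitmx.
  apply: smooth_germ_unitmx SA0 _.
  by rewrite unitmxE /A0 dNh det_ublock !det1 mulr1 unitr1.
pose dpos_at (i : 'I_(s + p)) (u : 'rV[R]_(m + k)) : Prop := 0 < d u ord0 i.
have dpos : \forall u \near nbhs (0 : 'rV[R]_(m + k)), forall i, dpos_at i u.
  apply: filter_forall => i.
  have cd := smooth_germ_continuous ((smooth_germ_mxP _).1 Sd ord0 i).
  apply: (cvgr_gt _ cd); rewrite /d; case: (split_ordP i) => a ->.
    by rewrite row_mxEl mxE.
  by rewrite row_mxEr !mxE Phi0 oppr_gt0 gneg.
have Sc a b (f : 'rV[R]_(m + k) -> 'M[R]_(a, b)) : smooth_germ f ->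
    smooth_germ (fun x => f (Psi x)) by move=> Sf; exact: smooth_germ_comp.
split=> //; exists Phi, Psi, (fun x => diag_mx (d (Psi x))),
  (fun x => B0 (Psi x)), (fun x => A0 (Psi x)).
split=> //.
- split; [|exact: Sc|exact: Sc].
  by apply: smooth_germ_diag_mx; exact: Sc.
- by apply: filterS (diffeo_germ_near D dpos) => x; exact: pos_diag_mx.
- exact: diffeo_germ_near D A0u.
- have gN' := diffeo_germ_near D gN; have hN' := diffeo_germ_near D hN.
  have EF' := diffeo_germ_near D (near0_lsubmx k EF).
  have hZ' := diffeo_germ_near D (near0_lsubmx k hZ).
  near=> x.
  have xE : Phi (Psi x) = x by near: x.
  have [Eg Eh] : ineq E (lsubmx (Psi x)) = usubmx (ineq F (iota (lsubmx (Psi x)))) /\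
     equa E (lsubmx (Psi x)) = usubmx (equa F (iota (lsubmx (Psi x)))) by near: x.
  have Z : dsubmx (equa F (iota (lsubmx (Psi x)))) = 0 by near: x.
  have Hg : ineq F (Phi (Psi x)) = ineq F (Phi (row_mx (lsubmx (Psi x)) 0)) +
    Ng (Psi x) *m (rsubmx (Psi x))^T by near: x.
  have Hh : equa F (Phi (Psi x)) = equa F (Phi (row_mx (lsubmx (Psi x)) 0)) +
    Nh (Psi x) *m (rsubmx (Psi x))^T by near: x.
  rewrite /= /A0 /B0 /d xE !mul_block_col Eg Eh !mul0mx mul1mx !add0r.
  rewrite xE PhiE in Hg Hh.
  split; last first.
    rewrite -[equa F x]vsubmxK; congr col_mx.
      by rewrite Hh linearD /= -mul_usub_mx.
    by rewrite Hh linearD /= Z add0r -mul_dsub_mx.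
  rewrite diag_mx_row mul_block_col !mul0mx addr0 add0r add_col_mx addr0.
  rewrite diag_const_mx mul1mx -[LHS]vsubmxK; congr col_mx.
    by rewrite {1}Hg linearD /= -mul_usub_mx.
  by apply/matrixP => i j; rewrite (ord1 j) mul_diag_mx !mxE mulrN1 opprK.
Unshelve. all: by end_near. Qed.

End Reduction.

(** An enumeration [kappa] of [K] completes [sigma] to an injective self-map of a finite set, hence
    to a permutation. *)
Lemma enumerates_compl_perm (s p : nat) (sigma : 'I_s -> 'I_(s + p))
    (K : {set 'I_(s + p)}) : enumerates_compl sigma K -> #|K| = p ->
  exists t : 'S_(s + p),
    (forall a, t (lshift p a) = sigma a) /\ (forall b, t (rshift s b) \in K).
Proof.
move=> [sigma_inj sigmaK] Kp.
have sigmaNK a : sigma a \notin K by apply/sigmaK; exists a.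
pose kappa (b : 'I_p) : 'I_(s + p) := enum_val (cast_ord (esym Kp) b).
have kappaK b : kappa b \in K by exact: enum_valP.
pose f (i : 'I_(s + p)) := match fintype.split i with
  | inl a => sigma a | inr b => kappa b end.
have fl a : f (lshift p a) = sigma a by rewrite /f (unsplitK (inl a)).
have fr b : f (rshift s b) = kappa b by rewrite /f (unsplitK (inr b)).
have f_inj : injective f.
  move=> i j; case: (split_ordP i) => a ->; case: (split_ordP j) => b ->;
    rewrite ?fl ?fr.
  - by move/sigma_inj ->.
  - by move=> E; have := sigmaNK a; rewrite E kappaK.
  - by move=> E; have := sigmaNK b; rewrite -E kappaK.
  - by move/enum_val_inj/cast_ord_inj ->.
by exists (perm f_inj); split=> i; rewrite permE ?fl ?fr.
Qed.

(** Permuting the constraints places the kept ones first, in the order of [sigma] and [tau], and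
    leads to the block case. *)
Lemma KG_equiv_reduction (R : realType) (m k s p l : nat)
    (F : constraint_map R (m + k) (s + p) (l + k)) (E : constraint_map R m s l) :
  constraint_germ F -> reduction_of F E -> KG_equiv F (suspension k p E).
Proof.
move=> [Sg Sh h0] [K [I [sigma [tau [iota]]]]].
move=> [[/addnI Kp /addnI Ik _] gK indep [[Si i0] imm Zi _] [eK eI EF]].
have [t [tl tr]] := enumerates_compl_perm eK Kp.
have [u [ul ur]] := enumerates_compl_perm eI Ik.
have tauI a : tau a \notin I by apply/(eI.2 (tau a)); exists a.
have dh := smooth_germ_differentiable0 Sh.
pose F' := permuted_constraints F t u.
have dh' : differentiable (fun x => row_perm u (equa F x)) 0.
  apply/differentiable_mxP => i j.
  rewrite (_ : (fun y => _) = (fun y => equa F y (u i) j)).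
    by move/differentiable_mxP : dh; exact.
  by apply/funext => y; rewrite mxE.
apply: (KG_equiv_trans (KG_equiv_sym (KG_equiv_permuted F t u))).
have Srp a b (f : 'rV[R]_(m + k) -> 'M[R]_(a, b)) v :
    smooth_germ f -> smooth_germ (fun x => row_perm v (f x)).
  move=> Sf; apply: smooth_germ_eq (smooth_germ_mulmx (smooth_germ_cst _ (perm_mx v)) Sf).
  by move=> x; rewrite row_permE.
apply: (@KG_equiv_block_reduction _ _ _ _ _ _ _ _ iota) => //.
- split; [exact: Srp|exact: Srp|].
  by rewrite /= h0; apply/matrixP => i j; rewrite !mxE.
- by move=> b; rewrite /= mxE; exact: gK.
- apply: filterS Zi => y Zy; apply/matrixP => i j.
  by rewrite (ord1 j) !mxE; apply: Zy.
- move=> c Hc.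
  (* The coefficients of the last block are carried back to the original indices, with 0 on the kept
     ones, so that [indep] applies. *)
  pose c' i := match fintype.split ((u^-1)%g i) with
    | inl _ => 0 | inr j => c ord0 j end.
  have c'r j : c' (u (rshift l j)) = c ord0 j.
    by rewrite /c' permK (unsplitK (inr j)).
  suff c'0 : forall i, i \in I -> c' i = 0.
    by apply/rowP => j; rewrite mxE -c'r; apply: c'0; exact: ur.
  apply: indep => v; have /matrixP/(_ ord0 ord0) := Hc v.
  rewrite !mxE => Hv; rewrite -[RHS]Hv.
  (* After reindexing by [u], the indices in [I] are exactly those of the last block. *)
  rewrite (reindex_inj (@perm_inj _ u)) big_split_ord /= [X in X + _]big1; last first.
    by move=> a; rewrite ul (negbTE (tauI a)).
  rewrite add0r; apply: eq_big => [j|j _]; first exact: ur.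
  rewrite c'r mxE mulrC; congr (_ * _).
  rewrite derive_trmx_dsubmx // !mxE -(derive_coord _ _ _ dh') -deriveE.
    by congr ('D_v _ _); apply/funext => y; rewrite mxE.
  by move/differentiable_mxP : dh; exact.
- apply: filterS EF => y [-> ->] /=.
  by split; apply/matrixP => i j; rewrite !mxE ?tl ?ul.
Qed.

Theorem lemma2p1 (R : realType) (n n' q r m m' s l : nat)
    (F : constraint_map R n q r) (F' : constraint_map R n' q r)
    (E : constraint_map R m s l) (E' : constraint_map R m' s l)
    (hF : constraint_germ F) (hF' : constraint_germ F')
    (neF : nonempty_feasible_germ F) (neF' : nonempty_feasible_germ F')
    (redF : reduction_of F E) (redF' : reduction_of F' E')
    (EE' : KG_equiv E E') :
  KG_equiv F F'.
Proof.
have [K [I [_ [_ [_ [[sK lI mI] _ _ _ _]]]]]] := redF.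
have [K' [I' [_ [_ [_ [[_ lI' mI'] _ _ _ _]]]]]] := redF'.
(* Both reductions keep [l] of the [r] equalities, so they remove the same number and the two
   suspensions adjoin the same [k] coordinates. *)
have II' : #|I'| = #|I| by apply: (@addnI l); rewrite lI lI'.
rewrite II' in mI'; move: sK lI mI mI'.
(* The cardinals become variables, so that substitution turns [n], [n'], [q] and [r] into the sums
   that index the suspensions. *)
move: (#|K|) (#|I|) => p k sK lI mI mI' {lI' II' K K' I I' neF neF'}.
subst n n' q r.
have KF := KG_equiv_reduction hF redF.
have KF' := KG_equiv_reduction hF' redF'.
apply: KG_equiv_trans KF _; apply: KG_equiv_trans (KG_equiv_sym KF').
exact: KG_equiv_suspension.
Qed.
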